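(* Let $(R,\mathfrak m,k)$ be a singular local ring and let $M$ be an $R$-module of finite projective dimension. Let $\pi^M\colon M\to M/\mathfrak m M$ be the canonical map. Then $\operatorname{Ext}_R(k,\pi^M)=0$; that is, for every integer $n$ the induced map $\operatorname{Ext}^n_R(k,\pi^M)\colon \operatorname{Ext}^n_R(k,M)\to \operatorname{Ext}^n_R(k,M/\mathfrak m M)$ is zero.
   Context: A local ring $(R,\mathfrak m,k)$ is a commutative noetherian local ring $R$ with maximal ideal $\mathfrak m$ and residue field $k=R/\mathfrak m$. It is called singular when it is not a regular local ring. Modules are not assumed to be finitely generated. $\operatorname{Ext}_R(-,-)$ without superscript denotes the graded module $(\operatorname{Ext}^n_R(-,-))_{n\in\mathbb Z}$, with $\operatorname{Ext}^n=0$ for $n<0$. *)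

(* Defs.v *)
From HB Require Import structures.
From mathcomp Require Import all_boot all_order all_algebra.
From mathcomp Require Import boolp classical_sets functions.

Set Implicit Arguments.
Unset Strict Implicit.
Unset Printing Implicit Defensive.
Import GRing.Theory.
Local Open Scope ring_scope.
Local Open Scope quotient_scope.

Record submodule (R : pzRingType) (V : lmodType R) := Submodule {
  submodule_pred :> {pred V};
  submodule_closed : GRing.submod_closed submodule_pred
}.

HB.instance Definition _ (R : pzRingType) (V : lmodType R) (S : submodule V) :=
  GRing.isSubmodClosed.Build R V (submodule_pred S)
    (GRing.submod_closed_semi (submodule_closed S)).

Section SubQuotient.
Variables (R : pzRingType) (V : lmodType R) (S : submodule V).

Definition submod := {x : V | x \in S}.
HB.instance Definition _ := [isSub of submod for sval].
HB.instance Definition _ := [Choice of submod by <:].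

HB.instance Definition _ :=
  GRing.SubChoice_isSubLmodule.Build R V (submodule_pred S) submod
    (GRing.submod_closed_semi (submodule_closed S)).

Definition quotmod := Quotient.quot (submodule_pred S).
HB.instance Definition _ := GRing.Zmodule.on quotmod.
HB.instance Definition _ := EqQuotient.on quotmod.

Definition quotmod_pi (x : V) : quotmod := \pi_quotmod x.

Definition quotmod_scale (a : R) (x : quotmod) : quotmod :=
  quotmod_pi (a *: repr x).

Lemma quotmod_piP x y : quotmod_pi x = quotmod_pi y <-> x - y \in S.
Proof.
by rewrite /quotmod_pi Quotient.idealrBE; split=> [->|/eqP].
Qed.

Lemma quotmod_reprK x : quotmod_pi (repr x) = x.
Proof. exact: reprK. Qed.

Lemma quotmod_piD x y : quotmod_pi (x + y) = quotmod_pi x + quotmod_pi y.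
Proof. by rewrite /quotmod_pi !piE. Qed.

Lemma quotmod_piZ a x : quotmod_pi (a *: x) = quotmod_scale a (quotmod_pi x).
Proof.
apply/quotmod_piP; rewrite -scalerBr rpredZ //; apply/quotmod_piP.
by rewrite quotmod_reprK.
Qed.

Fact quotmod_scaleA a b x :
  quotmod_scale a (quotmod_scale b x) = quotmod_scale (a * b) x.
Proof. by rewrite -[x]quotmod_reprK -!quotmod_piZ scalerA. Qed.

Fact quotmod_scale1 : left_id 1 quotmod_scale.
Proof. by move=> x; rewrite -[x]quotmod_reprK -quotmod_piZ scale1r. Qed.

Fact quotmod_scaleDr : right_distributive quotmod_scale +%R.
Proof.
move=> a x y; rewrite -[x]quotmod_reprK -[y]quotmod_reprK.
by rewrite -quotmod_piD -!quotmod_piZ -quotmod_piD scalerDr.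
Qed.

Fact quotmod_scaleDl x : {morph quotmod_scale^~ x : a b / a + b}.
Proof.
move=> a b; rewrite -[x]quotmod_reprK -!quotmod_piZ -quotmod_piD.
by rewrite scalerDl.
Qed.

HB.instance Definition _ := GRing.Zmodule_isLmodule.Build R quotmod
  quotmod_scaleA quotmod_scale1 quotmod_scaleDr quotmod_scaleDl.

Fact quotmod_pi_linear : linear quotmod_pi.
Proof. by move=> a x y; rewrite quotmod_piD quotmod_piZ. Qed.

HB.instance Definition _ :=
  GRing.isLinear.Build R V quotmod *:%R quotmod_pi quotmod_pi_linear.

End SubQuotient.

Section LocalRings.
Variable R : comNzRingType.

Definition ideal := submodule R^o.

Definition generates (n : nat) (g : 'I_n -> R) (I : ideal) : Prop :=
  forall x : R, x \in I <-> exists c : 'I_n -> R, x = \sum_(i < n) c i * g i.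

Definition noetherian : Prop :=
  forall I : ideal, exists (n : nat) (g : 'I_n -> R), generates g I.

Definition maximal_ideal (I : ideal) : Prop :=
  1 \notin I /\
  forall J : ideal, {subset I <= J} -> 1 \notin J -> {subset J <= I}.

Definition is_local (m : ideal) : Prop :=
  maximal_ideal m /\ forall J : ideal, maximal_ideal J -> J =i m.

Definition prime_ideal (p : ideal) : Prop :=
  1 \notin p /\ forall a b : R, a * b \in p -> a \in p \/ b \in p.

Definition prime_chain (n : nat) (p : 'I_n.+1 -> ideal) : Prop :=
  (forall i, prime_ideal (p i)) /\
  forall i j : 'I_n.+1, (i < j)%N ->
    {subset p i <= p j} /\ ~ {subset p j <= p i}.

Definition has_krull_dim (n : nat) : Prop :=
  (exists p : 'I_n.+1 -> ideal, prime_chain p) /\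
  forall (l : nat) (p : 'I_l.+1 -> ideal), prime_chain p -> (l <= n)%N.

Definition min_number_of_generators (I : ideal) (n : nat) : Prop :=
  (exists g : 'I_n -> R, generates g I) /\
  forall (l : nat) (g : 'I_l -> R), generates g I -> (n <= l)%N.

(* For R noetherian local with maximal ideal m. *)
Definition regular_local (m : ideal) : Prop :=
  exists n : nat, has_krull_dim n /\ min_number_of_generators m n.

End LocalRings.

Section IdealTimesModule.
Variables (R : comNzRingType) (I : ideal R) (M : lmodType R).

Definition ideal_mul_pred : {pred M} := [pred x | `[< exists (n : nat)
  (a : 'I_n -> R) (v : 'I_n -> M),
  (forall i, a i \in I) /\ x = \sum_(i < n) a i *: v i >]].

Fact ideal_mul_closed : submod_closed ideal_mul_pred.
Proof.
split.
  by apply/asboolP; exists 0, (fun=> 0), (fun=> 0); rewrite big_ord0; split=> // -[].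
move=> b _ _ /asboolP[n1 [a1 [v1 [h1 ->]]]] /asboolP[n2 [a2 [v2 [h2 ->]]]].
apply/asboolP; exists (n1 + n2)%N.
exists (fun i => match fintype.split i with inl j => a1 j | inr j => a2 j end).
exists (fun i => match fintype.split i with inl j => b *: v1 j | inr j => v2 j end).
split=> [i|]; first by case: (fintype.split i).
rewrite big_split_ord /= scaler_sumr; congr (_ + _); apply: eq_bigr => i _.
  by rewrite (unsplitK (inl i)) !scalerA mulrC.
by rewrite (unsplitK (inr i)).
Qed.

Definition ideal_mul : submodule M := Submodule ideal_mul_closed.

Definition canonical_map : {linear M -> quotmod ideal_mul} :=
  @quotmod_pi R M ideal_mul.

End IdealTimesModule.

(* k = R / m, as an R-module. *)
Definition residue_field (R : comNzRingType) (m : ideal R) : lmodType R :=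
  quotmod m.

Section Resolutions.
Variable R : comNzRingType.

Definition projective (P : lmodType R) : Prop :=
  forall (A B : lmodType R) (g : {linear A -> B}) (f : {linear P -> B}),
    (forall b, exists a, g a = b) ->
    exists h : {linear P -> A}, forall x, g (h x) = f x.

Record proj_resolution (N : lmodType R) := ProjResolution {
  res_mod :> nat -> lmodType R;
  res_diff : forall n, {linear res_mod n.+1 -> res_mod n};
  res_aug : {linear res_mod 0 -> N};
  res_projective : forall n, projective (res_mod n);
  res_aug_surj : forall y, exists x, res_aug x = y;
  res_exact0 : forall x, res_aug x = 0 <-> exists y, x = res_diff 0 y;
  res_exactS : forall n x,
    res_diff n x = 0 <-> exists y, x = res_diff n.+1 y
}.

Definition finite_proj_dim (M : lmodType R) : Prop :=
  exists (P : proj_resolution M) (l : nat),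
    forall n, (l < n)%N -> forall x : P n, x = 0.

End Resolutions.

(* Every module has a projective (indeed free) resolution, so the quantification
   over resolutions of the residue field in the statement is not vacuous. *)
Section ResolutionExistence.
Variable R : comNzRingType.

Section FreeModule.
Variable T : choiceType.

Definition finsupp_pred : {pred T -> R^o} :=
  [pred f | `[< exists s : seq T, forall x, f x != 0 -> x \in s >]].

Fact finsupp_closed : submod_closed finsupp_pred.
Proof.
split; first by apply/asboolP; exists [::] => x; rewrite eqxx.
move=> a f g /asboolP[s hs] /asboolP[t ht]; apply/asboolP; exists (s ++ t) => x.
rewrite mem_cat !fctE; apply: contraNT; rewrite negb_or => /andP[xs xt].
have /eqP -> : f x == 0 by apply: contraNT xs; apply: hs.
have /eqP -> : g x == 0 by apply: contraNT xt; apply: ht.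
by rewrite scaler0 addr0.
Qed.

Definition free_mod : lmodType R := submod (Submodule finsupp_closed).
Implicit Types u v : free_mod.

Definition free_coeff u (x : T) : R := val u x.

Fact suppP u : exists s : seq T, uniq s /\ forall x, free_coeff u x != 0 -> x \in s.
Proof.
have /asboolP[s hs] := valP u; exists (undup s); split; first exact: undup_uniq.
by move=> x; rewrite mem_undup; apply: hs.
Qed.

Definition free_supp u : seq T := projT1 (cid (suppP u)).
Lemma supp_uniq u : uniq (free_supp u).
Proof. by rewrite /free_supp; case: cid => s []. Qed.
Lemma mem_supp u x : free_coeff u x != 0 -> x \in free_supp u.
Proof. by rewrite /free_supp; case: cid => s [? h] /h. Qed.

Definition free_ext (A : lmodType R) (a : T -> A) u : A :=
  \sum_(x <- free_supp u) free_coeff u x *: a x.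

Lemma free_extE (A : lmodType R) (a : T -> A) u (s : seq T) :
  uniq s -> (forall x, free_coeff u x != 0 -> x \in s) ->
  free_ext a u = \sum_(x <- s) free_coeff u x *: a x.
Proof.
move=> us hs; rewrite /free_ext.
have E (t : seq T) : \sum_(x <- t) free_coeff u x *: a x =
    \sum_(x <- [seq x <- t | free_coeff u x != 0]) free_coeff u x *: a x.
  rewrite big_filter [RHS]big_mkcond; apply: eq_bigr => x _.
  by case: eqP => [->|] //=; rewrite scale0r.
rewrite E [RHS]E; apply: perm_big; apply: uniq_perm.
- exact/filter_uniq/supp_uniq.
- exact: filter_uniq.
move=> x; rewrite !mem_filter; case h: (free_coeff u x != 0) => //=.
by rewrite mem_supp // hs.
Qed.

Fact free_ext_linear (A : lmodType R) (a : T -> A) : linear (free_ext a).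
Proof.
move=> b u v; pose s := undup (free_supp u ++ free_supp v).
have us : uniq s by exact: undup_uniq.
have hu x : free_coeff u x != 0 -> x \in s.
  by rewrite mem_undup mem_cat => /mem_supp ->.
have hv x : free_coeff v x != 0 -> x \in s.
  by rewrite mem_undup mem_cat => /mem_supp ->; rewrite orbT.
have D x : free_coeff (b *: u + v) x = b * free_coeff u x + free_coeff v x.
  by rewrite /free_coeff linearP.
have huv x : free_coeff (b *: u + v) x != 0 -> x \in s.
  apply: contraNT => xs; rewrite D.
  have /eqP -> : free_coeff u x == 0 by apply: contraNT xs; apply: hu.
  have /eqP -> : free_coeff v x == 0 by apply: contraNT xs; apply: hv.
  by rewrite mulr0 addr0.
rewrite !(@free_extE _ _ _ s) // scaler_sumr -big_split /=.
by apply: eq_bigr => x _; rewrite D scalerDl scalerA.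
Qed.

HB.instance Definition _ (A : lmodType R) (a : T -> A) :=
  GRing.isLinear.Build R free_mod A *:%R (free_ext a) (free_ext_linear a).

Fact free_delta_subproof (x : T) : (fun y => (y == x)%:R : R^o) \in finsupp_pred.
Proof.
by apply/asboolP; exists [:: x] => y; rewrite inE; case: (y == x); rewrite ?eqxx.
Qed.
Definition free_delta x : free_mod :=
  Sub (fun y => (y == x)%:R : R^o) (free_delta_subproof x).

Lemma coeff_free_delta x y : free_coeff (free_delta x) y = (y == x)%:R.
Proof. by []. Qed.

Lemma free_ext_delta (A : lmodType R) (a : T -> A) x : free_ext a (free_delta x) = a x.
Proof.
rewrite (@free_extE _ _ _ [:: x]) // => [|y].
  by rewrite big_seq1 coeff_free_delta eqxx scale1r.
by rewrite coeff_free_delta inE; case: (y == x) => //; rewrite eqxx.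
Qed.

Lemma coeff_sum (s : seq T) (c : T -> R) (v : T -> free_mod) x :
  free_coeff (\sum_(y <- s) c y *: v y) x = \sum_(y <- s) c y * free_coeff (v y) x.
Proof.
elim: s => [|y s IH]; first by rewrite !big_nil.
by rewrite !big_cons -IH /free_coeff linearP.
Qed.

Lemma free_expand u : u = \sum_(x <- free_supp u) free_coeff u x *: free_delta x.
Proof.
apply/val_inj/funext => x; rewrite -![val _ x]/(free_coeff _ x) coeff_sum.
under eq_bigr do rewrite coeff_free_delta.
have [xs|xs] := boolP (x \in free_supp u).
  rewrite (bigD1_seq x) ?supp_uniq //= eqxx mulr1 big1 ?addr0 // => y.
  by rewrite eq_sym => /negPf ->; rewrite mulr0.
rewrite big_seq big1 => [|y ys]; first by apply/eqP; apply: contraNT xs; apply: mem_supp.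
by case: eqP ys xs => [<- ->|] //; rewrite mulr0.
Qed.

Lemma free_projective : projective free_mod.
Proof.
move=> A B g f g_surj.
have [a ha] := choice (fun x => g_surj (f (free_delta x))).
exists (free_ext a) => u.
rewrite {2}(free_expand u) /= /free_ext !linear_sum; apply: eq_bigr => x _.
by rewrite !linearZ /= ha.
Qed.

End FreeModule.

Section Kernel.
Variables (U V : lmodType R) (f : {linear U -> V}).
Fact ker_closed : submod_closed [pred x | f x == 0].
Proof.
split=> [|a x y]; rewrite !inE ?linear0 // => /eqP hx /eqP hy.
by rewrite linearP hx hy scaler0 addr0.
Qed.
Definition kernel : submodule U := Submodule ker_closed.
End Kernel.

Definition free_cover (N : lmodType R) : {linear free_mod N -> N} := free_ext id.

Fixpoint syzygy (N : lmodType R) (n : nat) : lmodType R :=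
  if n is k.+1 then submod (kernel (free_cover (syzygy N k))) else N.

Definition syzygy_diff N n : {linear free_mod (syzygy N n.+1) -> free_mod (syzygy N n)} :=
  val \o free_cover (syzygy N n.+1).

Lemma exact_cover N n x : free_cover (syzygy N n) x = 0 <->
  exists y, x = syzygy_diff N n y.
Proof.
split=> [/eqP hx|[y ->]]; last by exact/eqP/(valP (free_cover (syzygy N n.+1) y)).
by exists (free_delta (Sub x hx : syzygy N n.+1)); rewrite /syzygy_diff /= free_ext_delta.
Qed.

Lemma proj_resolution_exists (N : lmodType R) : inhabited (proj_resolution N).
Proof.
split.
apply: (@ProjResolution R N (fun n => free_mod (syzygy N n)) (syzygy_diff N)
  (free_cover N)).
- by move=> n; exact: free_projective.
- by move=> y; exists (free_delta y); rewrite /free_cover /= free_ext_delta.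
- by move=> x; exact: (@exact_cover N 0 x).
- move=> n x; rewrite -exact_cover; split=> [h|h].
    exact/val_inj.
  by change (val (free_cover (syzygy N n.+1) x) = 0); rewrite h.
Qed.
End ResolutionExistence.

(* Ext^n_R(N, M) as the n-th cohomology of Hom_R(P, M), for P a projective
   resolution of N.  The Hom modules are carved out of the modules of all
   functions P n -> M with pointwise operations. *)
Section Ext.
Variables (R : comNzRingType) (N : lmodType R) (P : proj_resolution N).

Section Cochains.
Variable M : lmodType R.

Definition cocycle_pred (n : nat) : {pred P n -> M} :=
  [pred f | `[< linear f /\ forall x, f (res_diff P n x) = 0 >]].

Fact cocycle_closed n : submod_closed (@cocycle_pred n).
Proof.
split; first by apply/asboolP; split=> [a x y|x]; rewrite ?scaler0 ?addr0.
move=> b f g /asboolP[lf zf] /asboolP[lg zg]; apply/asboolP; split.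
  move=> a x y; rewrite !fctE lf lg !scalerDr addrACA !scalerA.
  by rewrite [b * a]mulrC.
by move=> x; rewrite !fctE zf zg scaler0 addr0.
Qed.

Definition cocycles n : submodule (P n -> M) := Submodule (cocycle_closed n).

Definition is_coboundary (n : nat) : (P n -> M) -> Prop :=
  match n with
  | 0 => fun f => forall x, f x = 0
  | n'.+1 => fun f => exists2 g : P n' -> M, linear g &
                        forall x, f x = g (res_diff P n' x)
  end.

Definition coboundary_pred (n : nat) : {pred submod (cocycles n)} :=
  [pred f | `[< is_coboundary (val f) >]].

Fact coboundary_closed n : submod_closed (@coboundary_pred n).
Proof.
split.
  apply/asboolP; case: n => [|n] //=; exists (fun=> 0) => // a x y.
  by rewrite scaler0 addr0.
move=> b f1 f2 /asboolP h1 /asboolP h2; apply/asboolP.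
rewrite linearP /=; case: n f1 f2 h1 h2 => [|n] f1 f2 /=.
  by move=> h1 h2 x; rewrite !fctE h1 h2 scaler0 addr0.
move=> [g1 l1 h1] [g2 l2 h2]; exists (b *: g1 + g2) => [a x y|x].
  rewrite !fctE l1 l2 !scalerDr addrACA !scalerA.
  by rewrite [b * a]mulrC.
by rewrite !fctE h1 h2.
Qed.

Definition coboundaries n : submodule (submod (cocycles n)) :=
  Submodule (coboundary_closed n).

Definition Ext_nat (n : nat) : lmodType R := quotmod (coboundaries n).

Definition Ext (n : int) : lmodType R :=
  match n with
  | Posz n => Ext_nat n
  | Negz _ => 'rV[R]_0
  end.

End Cochains.

Section Functoriality.
Variables (M M' : lmodType R) (f : {linear M -> M'}).

Fact comp_cocycle n (z : submod (cocycles M n)) :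
  f \o val z \in cocycles M' n.
Proof.
have /asboolP[lz hz] := valP z; apply/asboolP; split=> [a x y|x] /=.
  by rewrite lz linearP.
by rewrite hz linear0.
Qed.

Definition cocycle_map n (z : submod (cocycles M n)) : submod (cocycles M' n) :=
  Sub (f \o val z) (comp_cocycle z).

Definition Ext_map_nat (n : nat) (x : Ext_nat M n) : Ext_nat M' n :=
  quotmod_pi (coboundaries M' n) (cocycle_map (repr (x : quotmod _))).

(* Ext_map_nat does not depend on the representative of the class. *)
Lemma Ext_map_natE n (z : submod (cocycles M n)) :
  Ext_map_nat (quotmod_pi (coboundaries M n) z) =
  quotmod_pi (coboundaries M' n) (cocycle_map z).
Proof.
apply/quotmod_piP; set y := repr _.
have /quotmod_piP/asboolP : quotmod_pi (coboundaries M n) y =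
  quotmod_pi (coboundaries M n) z by exact: quotmod_reprK.
move=> h; apply/asboolP; case: n z y h => [|n] z y /=.
  by move=> h x; have := h x; rewrite !fctE /= -linearB => ->; rewrite linear0.
move=> [g lg h]; exists (f \o g) => [a u v|x] /=; first by rewrite lg linearP.
by rewrite -h !fctE /= linearB.
Qed.

Definition Ext_map (n : int) : Ext M n -> Ext M' n :=
  match n with
  | Posz n => @Ext_map_nat n
  | Negz _ => fun=> 0
  end.

End Functoriality.
End Ext.

(* Main.v *)
Require Import Defs.
From HB Require Import structures.
From mathcomp Require Import all_boot all_order all_algebra.
From mathcomp Require Import boolp classical_sets.
From mathcomp Require Import ring zify.

Set Implicit Arguments.
Unset Strict Implicit.
Unset Printing Implicit Defensive.
Import GRing.Theory.
Local Open Scope ring_scope.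

(** Let G be the minimal free resolution of k. Since R is noetherian, G consists
of finite free modules, so its differentials are matrices with entries in m.
By comparison of resolutions a class in Ext^n(k, M) is a cocycle f : G_n -> M,
and all coboundaries G_n -> M / m M vanish; hence the claim is that f takes its
values in m M ([minimal_cocycle_vanishes]).

If f e is not in m M, choose a linear map v : M -> k with v (f e) <> 0. Let F be
a projective resolution of M of finite length. Lifting f to a chain map from G,
shifted by n, to F, and v to a chain map F -> G, one obtains a chain map
Psi : G -> G of degree -n that vanishes in high degrees, because F does, while
Psi e is a unit in G_0 = R. So the theorem follows from
[bounded_chain_map_minimal]: a chain map G -> G of degree -n that vanishes in
high degrees maps G_n into m G_0.

That lemma is proved by lowering the top degree l + n in which Psi is nonzero.
The component there is a sum of alpha_q times b_q, with b_q the basis of G_l and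
alpha_q : G_(l+n) -> R cocycles. By [cocycle_entries] alpha_q takes its values
in m. The class of b_q in Tor_l(k, k) is a cycle in the tensor product of k and
G, and so lifts to a chain map W : G -> G (x) G of degree l, with leading term
id (x) b_q ([tensor_lift]). The composite (alpha_q (x) 1) W is a chain map G -> G
of degree -n with the same top component alpha_q b_q, and all its entries lie in
m since those of alpha_q do ([chain_correction]). Subtracting these composites
does not change Psi_0 modulo m and lowers l.

The cocycle lemma is the case M = R, and it is where singularity enters. Take an
ideal J that is maximal among those generated by a regular sequence whose members
are linearly independent modulo the square of m. If J = m then R is regular: the
regular sequence produces a chain of primes of the right length, and Krull's
height theorem ([krull_height]) bounds all chains. Otherwise there is s in m,
outside J, with m s contained in J ([singular_socle]). The natural map from
Tor(k, R / J) to Tor(k, k) is injective ([regular_ideal_cycles]): a cycle of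
G / J G lying in m G is a boundary of G / J G. For a basis vector e of G_n the
element s e is such a cycle, so that s e is in the image of G_(n+1) plus J G_n. A
cocycle alpha : G_n -> R therefore satisfies s alpha(e) in J, and alpha(e) cannot
be a unit as s is not in J. *)

(** * Ideals of a noetherian ring *)

(** The invariant P lets a step depend on what the previous ones have achieved;
resolutions, chain maps and homotopies are all built degree by degree this
way. *)
Lemma dependent_choice_nat (T : nat -> Type) (P : forall n, T n -> Prop)
    (Q : forall n, T n -> T n.+1 -> Prop) :
  (exists x, P 0%N x) ->
  (forall n x, P n x -> exists y, P n.+1 y /\ Q n x y) ->
  exists f : forall n, T n, (forall n, P n (f n)) /\ forall n, Q n (f n) (f n.+1).
Proof.
move=> /cid[x0 P0] step.
pose next n (s : {x : T n | P n x}) : {y : T n.+1 | P n.+1 y} :=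
  let w := cid (step n (sval s) (svalP s)) in exist _ (sval w) (svalP w).1.
pose fix st n : {x : T n | P n x} :=
  if n is k.+1 then next k (st k) else exist _ x0 P0.
exists (fun n => sval (st n)); split=> n; first exact: svalP.
exact: (svalP (cid (step n (sval (st n)) (svalP (st n))))).2.
Qed.

Section Ideals.
Variable R : comNzRingType.
Implicit Types (I J K p q : R -> Prop) (a b r s u x y z : R).

(** Ideals are handled as plain predicates, since most of those needed below are
described by existential formulas; [to_ideal] converts them. *)
Definition is_ideal I := I 0 /\ forall a x y, I x -> I y -> I (a * x + y).

Definition ideal_le I J := forall x, I x -> J x.

Lemma ideal0 I : is_ideal I -> I 0. Proof. by case. Qed.
Lemma idealD I x y : is_ideal I -> I x -> I y -> I (x + y).
Proof. by move=> [_ h] hx hy; rewrite -[x]mul1r; apply: h. Qed.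
Lemma idealM I a x : is_ideal I -> I x -> I (a * x).
Proof. by move=> [h0 h] hx; rewrite -[a * x]addr0; apply: h. Qed.
Lemma ideal_mulr I a x : is_ideal I -> I x -> I (x * a).
Proof. by move=> hI hx; rewrite mulrC; apply: idealM. Qed.
Lemma idealN I x : is_ideal I -> I x -> I (- x).
Proof. by move=> hI; rewrite -mulN1r; apply: idealM. Qed.
Lemma idealB I x y : is_ideal I -> I x -> I y -> I (x - y).
Proof. by move=> hI hx hy; apply: idealD => //; apply: idealN. Qed.
Lemma ideal_sum I (T : finType) (F : T -> R) :
  is_ideal I -> (forall i, I (F i)) -> I (\sum_i F i).
Proof.
move=> hI h; elim/big_ind: _ => //; first exact: ideal0.
by move=> x y; apply: idealD.
Qed.

Lemma ideal_of_submodule (I : ideal R) : is_ideal (fun x => x \in I).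
Proof. by case: (submodule_closed I) => h0 h; split=> // a x y; apply: h. Qed.

Fact asbool_ideal_closed I : is_ideal I ->
  GRing.submod_closed ([pred x : R^o | `[< I x >]] : {pred R^o}).
Proof.
move=> hI; split; first by apply/asboolP; apply: ideal0.
by move=> a x y /asboolP hx /asboolP hy; apply/asboolP; case: hI => _; apply.
Qed.
Definition to_ideal I (hI : is_ideal I) : ideal R :=
  Submodule (asbool_ideal_closed hI).
Lemma in_to_ideal I (hI : is_ideal I) x : x \in to_ideal hI <-> I x.
Proof. by split=> /asboolP. Qed.

Definition zero_ideal : R -> Prop := fun x => x = 0.

Lemma zero_idealP : is_ideal zero_ideal.
Proof. by split=> // a _ _ -> ->; rewrite mulr0 addr0. Qed.

Lemma generator_mem n (g : 'I_n -> R) (I : ideal R) i : generates g I -> g i \in I.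
Proof.
move=> gI; apply/gI; exists (fun j => (j == i)%:R).
by rewrite (bigD1 i) //= eqxx mul1r big1 ?addr0 // => j /negPf ->; rewrite mul0r.
Qed.

Definition adjoin I z : R -> Prop := fun x => exists a b, I b /\ x = a * z + b.

Lemma adjoin_ideal I z : is_ideal I -> is_ideal (adjoin I z).
Proof.
move=> hI; split; first by exists 0, 0; rewrite mul0r addr0; split=> //; exact: ideal0.
move=> a _ _ [c [b [hb ->]]] [c' [b' [hb' ->]]].
exists (a * c + c'), (a * b + b'); split; last by ring.
by apply: idealD => //; apply: idealM.
Qed.
Lemma sub_adjoin I z : ideal_le I (adjoin I z).
Proof. by move=> x hx; exists 0, x; rewrite mul0r add0r. Qed.
Lemma mem_adjoin I z : is_ideal I -> adjoin I z z.
Proof. by move=> hI; exists 1, 0; rewrite mul1r addr0; split=> //; exact: ideal0. Qed.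
Lemma adjoin_sub I z J : is_ideal J -> ideal_le I J -> J z -> ideal_le (adjoin I z) J.
Proof.
by move=> hJ IJ Jz x [a [b [/IJ hb ->]]]; apply: idealD => //; apply: idealM.
Qed.

Definition is_prime p :=
  [/\ is_ideal p, ~ p 1 & forall a b, p (a * b) -> p a \/ p b].

Lemma primeX p x n : is_prime p -> p (x ^+ n) -> p x.
Proof.
move=> [_ p1 pM]; elim: n => [/p1 //|n IH]; rewrite exprS => /pM[] //.
Qed.

Lemma prime_notM p a b : is_prime p -> ~ p a -> ~ p b -> ~ p (a * b).
Proof. by move=> [_ _ pM] na nb /pM[]. Qed.

Section Noetherian.
Hypothesis noeth : noetherian R.

(** Otherwise dependent choice gives a strictly ascending sequence; its union is
generated by finitely many elements, which already lie in one member. *)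
Lemma noetherian_max (F : (R -> Prop) -> Prop) :
  (forall I, F I -> is_ideal I) -> (exists I, F I) ->
  exists I, F I /\ forall J, F J -> ideal_le I J -> ideal_le J I.
Proof.
move=> Fid exF; apply: contrapT => nomax.
have [||c [Fc cS]] := @dependent_choice_nat (fun=> R -> Prop) (fun=> F)
    (fun _ I J => ideal_le I J /\ ~ ideal_le J I) => //.
  move=> _ I FI; apply: contrapT => h; apply: nomax; exists I; split=> // J FJ IJ.
  by apply: contrapT => JI; apply: h; exists J.
have mono i j : (i <= j)%N -> ideal_le (c i) (c j).
  move=> /subnK <-; elim: (j - i)%N => [//|k IH] x /IH.
  exact: (cS _).1.
have Uid : is_ideal (fun x => exists i, c i x).
  split; first by exists 0%N; exact: ideal0 (Fid _ (Fc 0%N)).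
  move=> a x y [i hi] [j hj]; exists (maxn i j).
  case: (Fid _ (Fc (maxn i j))) => _; apply; first exact: mono (leq_maxl _ _) _ hi.
  exact: mono (leq_maxr _ _) _ hj.
have [n [g hg]] := noeth (to_ideal Uid).
have gU i : exists k, c k (g i).
  exact/(in_to_ideal Uid)/generator_mem.
have [k hk] := choice gU.
have [_] := cS (\max_i k i); apply=> x hx.
have /hg[d ->] : x \in to_ideal Uid by apply/in_to_ideal; exists (\max_i k i).+1.
have hI := Fid _ (Fc (\max_i k i)).
apply: ideal_sum => // i; apply: idealM => //; apply: mono (hk i).
exact: leq_bigmax.
Qed.

(** An ideal maximal among those that contain I and avoid S is prime. *)
Lemma exists_prime_avoiding I (S : R -> Prop) :
  is_ideal I -> S 1 -> (forall a b, S a -> S b -> S (a * b)) ->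
  (forall x, I x -> ~ S x) ->
  exists p, [/\ is_prime p, ideal_le I p & forall x, p x -> ~ S x].
Proof.
move=> hI S1 SM IS.
have [||p [[hp Ip pS] pmax]] := @noetherian_max (fun K =>
  [/\ is_ideal K, ideal_le I K & forall x, K x -> ~ S x]); first by move=> K [].
  by exists I; split.
have meet a : ~ p a -> exists s, S s /\ adjoin p a s.
  move=> na; apply: contrapT => h; apply: na.
  apply: (pmax (adjoin p a)); last exact: mem_adjoin; last exact: sub_adjoin.
  split; first exact: adjoin_ideal.
    by move=> x /Ip; apply: sub_adjoin.
  by move=> x hx Sx; apply: h; exists x.
exists p; split=> //; split=> //; first by move=> /pS.
move=> a b pab; apply: contrapT => /not_orP[/meet[s [Ss [c [d [pd e]]]]]].
move=> /meet[s' [Ss' [c' [d' [pd' e']]]]].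
apply: (pS (s * s')); last exact: SM.
have -> : s * s' = c * c' * (a * b) + (c * a * d' + d * s').
  by rewrite e e'; ring.
apply: idealD => //; first exact: idealM.
by apply: idealD => //; [apply: idealM | apply: ideal_mulr].
Qed.

(** The p-saturated ideals are the contractions of the ideals of the localization
at p; using them avoids constructing that localization. *)
Definition saturated p I := forall u x, ~ p u -> I (u * x) -> I x.

Definition saturation p I : R -> Prop := fun x => exists u, ~ p u /\ I (u * x).

Section Saturation.
Variables p : R -> Prop.
Hypothesis pp : is_prime p.

Lemma saturation_ideal I : is_ideal I -> is_ideal (saturation p I).
Proof.
move=> hI; have [hp p1 _] := pp; split.
  by exists 1; rewrite mulr0; split=> //; exact: ideal0.
move=> a x y [u [nu hx]] [v [nv hy]]; exists (u * v); split; first exact: prime_notM.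
have -> : u * v * (a * x + y) = (v * a) * (u * x) + u * (v * y) by ring.
by apply: idealD => //; apply: idealM.
Qed.

Lemma sub_saturation I : ideal_le I (saturation p I).
Proof. by have [_ p1 _] := pp; move=> x hx; exists 1; rewrite mul1r. Qed.

Lemma saturationP I : saturated p (saturation p I).
Proof.
move=> u x nu [v [nv h]]; exists (v * u); split; first exact: prime_notM.
by rewrite -mulrA.
Qed.

Lemma saturation_sub I J : saturated p J -> ideal_le I J -> ideal_le (saturation p I) J.
Proof. by move=> sJ IJ x [u [nu /IJ]]; apply: sJ. Qed.

(** Nakayama's lemma for the localization of I / K at p. The last hypothesis says
that I is contained in the saturation of K + p I, phrased through the saturated
ideals B containing both K and p I. If I were not contained in K, a saturated B
maximal among those with K <= B < I would make I / B a simple module, killed by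
p; but then I <= B. *)
Lemma nakayama_saturated K I :
  is_ideal K -> saturated p K -> is_ideal I -> saturated p I -> ideal_le K I ->
  (forall B, is_ideal B -> saturated p B -> ideal_le K B ->
     (forall c x, p c -> I x -> B (c * x)) -> ideal_le I B) ->
  ideal_le I K.
Proof.
move=> hK sK hI sI KI H; have [hp p1 pM] := pp; apply: contrapT => nIK.
have [||B [[hB sB KB BI nIB] Bmax]] := @noetherian_max (fun B =>
  [/\ is_ideal B, saturated p B, ideal_le K B, ideal_le B I & ~ ideal_le I B]).
- by move=> B [].
- by exists K; split.
apply: (nIB); apply: (H B) => // c x pc Ix.
have [z /not_implyP[Iz nBz]] : exists z, ~ (I z -> B z) by apply/existsNP.
(* By maximality of B, any w in I outside B generates I over B, up to
   saturation. *)
have full w : I w -> ~ B w -> ideal_le I (saturation p (adjoin B w)).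
  move=> Iw nBw; apply: contrapT => nS; apply: nBw.
  apply: (Bmax (saturation p (adjoin B w))).
  - split=> //; first exact/saturation_ideal/adjoin_ideal.
    + exact: saturationP.
    + by move=> y /KB By; apply/sub_saturation/sub_adjoin.
    + by apply: saturation_sub => //; apply: adjoin_sub.
  - by move=> y By; apply/sub_saturation/sub_adjoin.
  - exact/sub_saturation/mem_adjoin.
have Bcz : B (c * z).
  move: (full (c * z) (idealM c hI Iz)) => fz; apply: contrapT => /fz /(_ z Iz).
  move=> [u [nu [r [b [Bb e]]]]].
  apply: nBz; apply: (sB (u - r * c)).
    by move=> h; apply: nu; rewrite -[u](subrK (r * c)); apply: idealD => //; apply: idealM.
  by rewrite mulrBl e; have -> : r * (c * z) + b - r * c * z = b by ring.
have [u [nu [r [b [Bb e]]]]] := full z Iz nBz x Ix.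
apply: (sB u) => //; rewrite mulrCA e mulrDr mulrCA.
by apply: idealD => //; apply: idealM.
Qed.

End Saturation.
End Noetherian.
End Ideals.

(** * Krull's height theorem *)

Section Krull.
Variable R : comNzRingType.
Hypothesis noeth : noetherian R.
Implicit Types (I J K p q : R -> Prop) (a b r s u x y z : R).

Definition colon J s : R -> Prop := fun x => J (x * s).

Lemma colon_ideal J s : is_ideal J -> is_ideal (colon J s).
Proof.
move=> hJ; split; first by rewrite /colon mul0r; exact: ideal0.
move=> a x y hx hy; rewrite /colon mulrDl -mulrA.
by apply: idealD => //; apply: idealM.
Qed.

Definition maximal_annihilator J s :=
  ~ J s /\ forall t, ~ J t -> ideal_le (colon J s) (colon J t) ->
    ideal_le (colon J t) (colon J s).

Lemma maximal_annihilator_exists J h : is_ideal J -> ~ J h ->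
  exists s, maximal_annihilator J s /\ ideal_le (colon J h) (colon J s).
Proof.
move=> hJ nJh.
have [||_ [[s [nJs -> hs]] smax]] := @noetherian_max _ noeth (fun K =>
  exists s, [/\ ~ J s, K = colon J s & ideal_le (colon J h) (colon J s)]).
- by move=> _ [s [_ -> _]]; exact: colon_ideal.
- by exists (colon J h), h; split.
exists s; split=> //; split=> // t nJt st; apply: smax => //.
by exists t; split=> // x /hs /st.
Qed.

(** If a b kills s modulo J and b does not, then b s is outside J and its
annihilator, which contains a, is no larger than that of s. *)
Lemma maximal_annihilator_prime J s :
  is_ideal J -> maximal_annihilator J s -> is_prime (colon J s).
Proof.
move=> hJ [nJs smax]; split; first exact: colon_ideal.
  by rewrite /colon mul1r.
move=> a b hab; apply: contrapT => /not_orP[na nb]; apply: na.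
apply: (smax (b * s)) => //; last by rewrite /colon mulrA.
by move=> x hx; rewrite /colon mulrCA; apply: idealM.
Qed.

(** The localization of R / I0 at a prime p minimal over I0 is artinian. Call B
stable if the sequence becomes constant after intersecting with B. The saturation
of I0 is stable. If B is stable and proper, a maximal annihilator of B is a prime
between I0 and p, hence equal to p; so some z outside B satisfies p z <= B, and
B + R z, being a simple extension of B locally at p, is stable too. A maximal
stable B is thus the whole ring. *)
Lemma saturated_dcc p I0 (J : nat -> R -> Prop) :
  is_prime p -> is_ideal I0 ->
  (forall q, is_prime q -> ideal_le I0 q -> ideal_le q p -> ideal_le p q) ->
  (forall n, [/\ is_ideal (J n), saturated p (J n), ideal_le I0 (J n) &
    ideal_le (J n.+1) (J n)]) ->
  exists n, ideal_le (J n) (J n.+1).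
Proof.
move=> pp hI0 pmin JP; have [hp p1 _] := pp.
have hJ n : is_ideal (J n) by case: (JP n).
have sJ n : saturated p (J n) by case: (JP n).
have mono i j : (i <= j)%N -> ideal_le (J j) (J i).
  move=> /subnK <-; elim: (j - i)%N => [//|k IH] x hx; apply: IH.
  by case: (JP (k + i)%N) => _ _ _; apply.
pose stable (B : R -> Prop) := exists n0, forall n x, (n0 <= n)%N -> J n0 x -> B x -> J n x.
suff [B [[hB sB IB [n0 Bn]] B1]] : exists B,
    [/\ is_ideal B, saturated p B, ideal_le I0 B & stable B] /\ B 1.
  exists n0 => x hx; apply: Bn => //.
  by rewrite -[x]mulr1; apply: idealM.
have [||B [[hB sB IB [n0 Bn]] Bmax]] := @noetherian_max _ noeth (fun B =>
    [/\ is_ideal B, saturated p B, ideal_le I0 B & stable B]); first by move=> B [].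
  exists (saturation p I0); split.
  - exact: saturation_ideal.
  - exact: saturationP.
  - exact: sub_saturation.
  - exists 0 => n x _ _; apply: saturation_sub => //; by case: (JP n).
exists B; split; first by split=> //; exists n0.
apply: contrapT => nB1.
have [z [zmax _]] := maximal_annihilator_exists hB nB1.
have [nBz _] := zmax.
have pz : ideal_le p (colon B z).
  apply: pmin; first exact: maximal_annihilator_prime.
    by move=> x /IB Bx; apply: ideal_mulr.
  by move=> x xz; apply: contrapT => npx; exact/nBz/(sB x).
apply: nBz; apply: (Bmax (saturation p (adjoin B z))); first last.
- exact/sub_saturation/mem_adjoin.
- by move=> x Bx; apply/sub_saturation/sub_adjoin.
split.
- exact/saturation_ideal/adjoin_ideal.
- exact: saturationP.
- by move=> x /IB Bx; apply/sub_saturation/sub_adjoin.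
(* Either some J n1 meets B' = B + R z only inside B, or every J n contains an
   element a of B' outside B; such an a generates B' over B locally at p. *)
have [[n1 h]|nh] := pselect (exists n1, forall x, J n1 x ->
    saturation p (adjoin B z) x -> B x).
  exists (maxn n0 n1) => n x ln hx Sx.
  apply: Bn; first by apply: leq_trans ln; apply: leq_maxl.
    by apply: mono hx; apply: leq_maxl.
  by apply: h => //; apply: mono hx; apply: leq_maxr.
exists n0 => n c ln Jc [w [nw [r' [b' [Bb' e']]]]].
have [a [Ja [[u [nu [r [b [Bb e]]]]] nBa]]] : exists a,
    J n a /\ (saturation p (adjoin B z) a /\ ~ B a).
  apply: contrapT => no; apply: nh; exists n => x Jx Sx.
  by apply: contrapT => nBx; apply: no; exists x.
have nr : ~ p r.
  move=> /pz Brz; apply: nBa; apply: (sB u) => //; rewrite e.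
  exact: idealD.
apply: (sJ n (r * w)); first exact: prime_notM.
have -> : r * w * c = r' * u * a + (r * b' - r' * b).
  have -> : r * w * c = r * (w * c) by ring.
  have -> : r' * u * a = r' * (u * a) by ring.
  by rewrite e e'; ring.
apply: idealD => //; first exact: idealM.
have Bd : B (r * b' - r' * b) by apply: idealB => //; apply: idealM.
apply: Bn => //.
have -> : r * b' - r' * b = r * w * c - r' * u * a.
  have -> : r * w * c = r * (w * c) by ring.
  have -> : r' * u * a = r' * (u * a) by ring.
  by rewrite e e'; ring.
by apply: idealB => //; apply: idealM => //; apply: mono Ja.
Qed.

Definition ideal_lt I J := ideal_le I J /\ ~ ideal_le J I.

(** Krull's principal ideal theorem, in the form used to move a chain of primes.
If the conclusion fails then x is outside p1 and p is minimal over q + R x. For y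
in p1 outside q, let I_n be the saturation at p1 of q + R y^n. The ideals
I_n + R x satisfy the descending chain condition locally at p, so that I_n is
contained in I_(n+1) + R x, and even in I_(n+1) + x I_n because x is a
nonzerodivisor modulo I_n. By Nakayama I_n = I_(n+1), so u y^n is in q + R y^(n+1)
for some u outside p1; this puts (u - r y) y^n, and hence y, in q. *)
Lemma prime_between q p1 p x :
  is_prime q -> is_prime p1 -> is_prime p ->
  ideal_lt q p1 -> ideal_lt p1 p -> p x ->
  exists q', [/\ is_prime q', ideal_lt q q', ideal_lt q' p & q' x].
Proof.
move=> qp p1p pp [qp1 nqp1] [p1p' np1p] px; apply: contrapT => no.
have [hq q1 qM] := qp; have [hp1 p11 p1M] := p1p; have [hp pn1 pM] := pp.
have np1x : ~ p1 x by move=> h; apply: no; exists p1; split.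
have nqx : ~ q x by move=> /qp1.
have pmin Q : is_prime Q -> ideal_le (adjoin q x) Q -> ideal_le Q p -> ideal_le p Q.
  move=> Qp qQ Qpp; apply: contrapT => npQ; apply: no; exists Q.
  have Qx : Q x by apply/qQ/mem_adjoin.
  split=> //; split=> //; first by move=> y qy; apply/qQ/sub_adjoin.
  by move/(_ x Qx).
have [y /not_implyP[p1y nqy]] : exists y, ~ (p1 y -> q y) by apply/existsNP.
pose I n := saturation p1 (adjoin q (y ^+ n)).
have hI n : is_ideal (I n) by exact/saturation_ideal/adjoin_ideal.
have sI1 n : saturated p1 (I n) by exact: saturationP.
have sI n : saturated p (I n).
  by move=> u a nu; apply: sI1 => /p1p'.
have qI n : ideal_le q (I n) by move=> a qa; apply/sub_saturation/sub_adjoin.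
have IS n : ideal_le (I n.+1) (I n).
  apply: saturation_sub => //; apply: adjoin_sub => //.
  by rewrite exprS; apply: idealM => //; apply/sub_saturation/mem_adjoin.
have [n Jn] : exists n, ideal_le (saturation p (adjoin (I n) x))
    (saturation p (adjoin (I n.+1) x)).
  apply: (@saturated_dcc p (adjoin q x)) => //; first exact: adjoin_ideal.
  move=> n; split.
  - exact/saturation_ideal/adjoin_ideal.
  - exact: saturationP.
  - apply: adjoin_sub; first exact/saturation_ideal/adjoin_ideal.
      by move=> a /(qI n) Ia; apply/sub_saturation/sub_adjoin.
    exact/sub_saturation/mem_adjoin.
  - apply: saturation_sub; first exact: saturationP.
    apply: adjoin_sub; first exact/saturation_ideal/adjoin_ideal.
      by move=> a /IS Ia; apply/sub_saturation/sub_adjoin.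
    exact/sub_saturation/mem_adjoin.
have InS : ideal_le (I n) (I n.+1).
  apply: (@nakayama_saturated _ noeth p) => // B hB sB IB pIB a Ia.
  have [//|s [ns [r [b [Ib e]]]]] := Jn a.
    exact/sub_saturation/sub_adjoin.
  apply: (sB s) => //; rewrite e; apply: idealD => //; last exact: IB.
  rewrite mulrC; apply: pIB => //; apply: (sI1 n x) => //.
  have -> : x * r = s * a - b by rewrite e; ring.
  by apply: idealB => //; [apply: idealM | apply: IS].
have [u [nu [r [b [qb e]]]]] : I n.+1 (y ^+ n).
  by apply: InS; apply/sub_saturation/mem_adjoin.
have : q ((u - r * y) * y ^+ n).
  have -> : (u - r * y) * y ^+ n = u * y ^+ n - r * y ^+ n.+1 by rewrite exprS; ring.
  by rewrite e; have -> : r * y ^+ n.+1 + b - r * y ^+ n.+1 = b by ring.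
move=> /qM[/qp1 h|]; last by move/(primeX qp).
by apply: nu; rewrite -[u](subrK (r * y)); apply: idealD => //; apply: idealM.
Qed.

Definition chain_of_primes l (c : nat -> R -> Prop) :=
  (forall i, (i <= l)%N -> is_prime (c i)) /\
  forall i, (i < l)%N -> ideal_lt (c i) (c i.+1).

(** Apply [prime_between] from the top of the chain downwards; only the bottom
prime is lost. *)
Lemma chain_through l c x : chain_of_primes l.+1 c -> c l.+1 x ->
  exists c', [/\ chain_of_primes l c', c' l = c l.+1, ideal_le (c 0%N) (c' 0%N) & c' 0%N x].
Proof.
elim: l c => [|l IH] c [cp cs] cx.
  exists (fun=> c 1); split=> //; last exact: (cs 0%N isT).1.
  by split=> // i _; apply: cp.
have [q' [q'p cq' q'c q'x]] := prime_between (cp l (leqW (leqnSn _)))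
  (cp l.+1 (leqnSn _)) (cp l.+2 (leqnn _)) (cs l (leqnSn _)) (cs l.+1 (leqnn _)) cx.
have [||c' [[c'p c's] c'l c'0 c'x]] := IH (fun i => if (i <= l)%N then c i else q').
- split=> i hi; first by case: ifP => // il; apply: cp; lia.
  rewrite ltnS in hi; rewrite hi; case: ifP => il; first by apply: cs; lia.
  by have -> : i = l by lia.
- by rewrite ltnn.
exists (fun i => if (i <= l)%N then c' i else c l.+2); split=> //=; last by rewrite ltnn.
move: c'l; rewrite ltnn => c'l.
split=> i hi; first by case: ifP => il; [apply: c'p | apply: cp].
rewrite ltnS in hi; rewrite hi; case: ifP => il; first by apply: c's; lia.
have -> : i = l by lia.
by rewrite c'l.
Qed.

(** The chain is made to start at a prime containing x, at the cost of one step;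
then x is moved from the list of generators into I. *)
Lemma krull_height (xs : seq R) I p l c :
  is_ideal I -> chain_of_primes l c -> c l = p -> ideal_le I (c 0%N) ->
  (forall x, x \in xs -> p x) ->
  (forall q, is_prime q -> ideal_le I q -> (forall x, x \in xs -> q x) ->
     ideal_le q p -> ideal_le p q) ->
  (l <= size xs)%N.
Proof.
elim: xs I l c => [|x xs IH] I l c hI cc cl Ic xsp pmin.
  case: l cc cl => // l [cp cs] cl; exfalso.
  have mono i : (i <= l.+1)%N -> ideal_le (c 0%N) (c i).
    elim: i => [|i IHi] il y hy; first by [].
    by apply: (cs i il).1; apply: IHi => //; exact: ltnW.
  have [_] := cs l (leqnn _); apply; rewrite cl => y py.
  apply: (mono l) => //; apply: (pmin (c 0%N)) => //; first exact: cp.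
  by rewrite -cl; apply: mono.
case: l cc cl => // l cc cl; rewrite /= ltnS.
have [|c' [c'c c'l c0 c'x]] := chain_through (x := x) cc.
  by rewrite cl; apply: xsp; rewrite mem_head.
apply: (IH (adjoin I x) l c') => //; first exact: adjoin_ideal.
- by rewrite c'l.
- apply: adjoin_sub => //; first by case: c'c => /(_ 0 isT)[].
  by move=> y /Ic /c0.
- by move=> y hy; apply: xsp; rewrite inE hy orbT.
move=> q qp Iq xsq qpp; apply: pmin => //.
  by move=> y Iy; apply/Iq/sub_adjoin.
by move=> y; rewrite inE => /orP[/eqP ->|]; [apply/Iq/mem_adjoin | apply: xsq].
Qed.

End Krull.

(** * Regular sequences and singularity *)

Section LocalRing.
Variables (R : comNzRingType) (m : ideal R).
Hypotheses (noeth : noetherian R) (m_local : is_local m).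
Implicit Types (I J K B p q : R -> Prop) (a b r s u x y z : R).

Let mm : R -> Prop := fun x => x \in m.

Lemma maxid_ideal : is_ideal mm. Proof. exact: ideal_of_submodule. Qed.

Lemma maxid_proper : ~ mm 1.
Proof. by move: m_local => [[/negP h _] _]. Qed.

Lemma proper_sub_maxid I : is_ideal I -> ~ I 1 -> ideal_le I mm.
Proof.
move=> hI nI1.
have [||K [[hK nK1 IK] Kmax]] := @noetherian_max _ noeth (fun K =>
  [/\ is_ideal K, ~ K 1 & ideal_le I K]); first by move=> K [].
  by exists I; split.
have Kmaximal : maximal_ideal (to_ideal hK).
  split; first by apply/negP => /(in_to_ideal hK) /nK1.
  move=> J KJ nJ1 x Jx; apply/(in_to_ideal hK).
  have KJ' : ideal_le K (fun y => y \in J) by move=> y /(in_to_ideal hK) /KJ.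
  apply: (Kmax _ _ KJ' x Jx); split; first exact: ideal_of_submodule.
    exact/negP.
  by move=> y /IK /KJ'.
by move=> x /IK /(in_to_ideal hK); rewrite (m_local.2 _ Kmaximal).
Qed.

Lemma unit_notin_maxid x : ~ mm x -> exists y, y * x = 1.
Proof.
move=> nx; apply: contrapT => nu.
apply: nx; apply: (proper_sub_maxid (adjoin_ideal x (@zero_idealP R))).
  2: exact/mem_adjoin/zero_idealP.
by move=> [a [b [-> e]]]; apply: nu; exists a; rewrite e addr0.
Qed.

Lemma maxid_prime : is_prime mm.
Proof.
split; [exact: maxid_ideal | exact: maxid_proper |] => a b ab.
apply: contrapT => /not_orP[/unit_notin_maxid[y e]]; apply.
by rewrite -[b]mul1r -e -mulrA; apply: idealM ab; exact: maxid_ideal.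
Qed.

Lemma cancel_unit I u x : is_ideal I -> ~ mm u -> I (u * x) -> I x.
Proof.
move=> hI /unit_notin_maxid[y e] Iux.
by rewrite -[x]mul1r -e -mulrA; apply: idealM.
Qed.

(** Nakayama's lemma for m / J. The ideal B stands in for J plus the square of
m: an element outside some such B is one that is nonzero in the cotangent space
of R / J. *)
Lemma nakayama_square J : is_ideal J -> ~ ideal_le mm J -> ideal_le J mm ->
  exists B, [/\ is_ideal B, ideal_le J B,
    forall a b, mm a -> mm b -> B (a * b) & ~ ideal_le mm B].
Proof.
move=> hJ nmJ Jm; apply: contrapT => nB; apply: nmJ.
apply: (nakayama_saturated noeth maxid_prime) => //.
- by move=> u x; apply: cancel_unit.
- exact: maxid_ideal.
- by move=> u x; apply: cancel_unit; exact: maxid_ideal.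
move=> B hB _ JB mB; apply: contrapT => nmB; apply: nB.
by exists B; split.
Qed.

Section PrimeAvoidance.
Variable J : R -> Prop.
Hypothesis hJ : is_ideal J.

(** The usual fact that a prime containing an intersection of finitely many ideals
contains one of them. *)
Lemma product_avoiding p (ts : seq R) : is_prime p ->
  (forall t, t \in ts -> ~ ideal_le (colon J t) p) ->
  exists y, ~ p y /\ forall t, t \in ts -> J (y * t).
Proof.
move=> pp; elim: ts => [|t ts IH] h.
  by exists 1; split=> //; case: pp.
have [|y [ny hy]] := IH.
  by move=> t' ht'; apply: h; rewrite inE ht' orbT.
have [z /not_implyP[hz nz]] : exists z, ~ (colon J t z -> p z).
  exact/existsNP/h/mem_head.
exists (y * z); split; first exact: prime_notM.
move=> t'; rewrite inE => /orP[/eqP ->|/hy].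
  by rewrite -mulrA; apply: idealM.
by move=> h'; rewrite mulrAC; apply: ideal_mulr.
Qed.

Hypothesis no_socle : forall s, ~ J s -> exists2 a, mm a & ~ J (a * s).
Variable B : R -> Prop.
Hypotheses (hB : is_ideal B) (mB : forall a b, mm a -> mm b -> B (a * b)).
Hypothesis nmB : ~ ideal_le mm B.

(** Prime avoidance for the primes (J : t) and the ideal B. If x avoids B and the
first primes but lies in the prime (J : t), add to x the element a * a * y, where a
is in m outside (J : t) and y is in all the first primes but not in (J : t); the
square of a keeps x outside B. Such a y exists because maximal annihilators are
pairwise equal or incomparable. *)
Lemma avoid_annihilators (ts : seq R) :
  (forall t, t \in ts -> maximal_annihilator J t) ->
  exists x, [/\ mm x, ~ B x & forall t, t \in ts -> ~ J (x * t)].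
Proof.
elim: ts => [|t ts IH] h.
  have [x /not_implyP[mx nx]] : exists x, ~ (mm x -> B x) by exact/existsNP.
  by exists x; split.
have tmax := h t (mem_head _ _).
have [|x [mx nBx hx]] := IH; first by move=> t' ht'; apply: h; rewrite inE ht' orbT.
have [Jxt|nJxt] := pselect (J (x * t)); last first.
  by exists x; split=> // t'; rewrite inE => /orP[/eqP ->|/hx].
have pp := maximal_annihilator_prime hJ tmax.
have [|y [ny hy]] := @product_avoiding (colon J t) ts pp.
  move=> t' ht' /(h t' _).2 le; apply: (hx _ ht'); apply: le Jxt.
    by rewrite inE ht' orbT.
  by case: tmax.
have [a ma na] := no_socle tmax.1.
have mz : mm (a * a * y).
  by apply: ideal_mulr; [exact: maxid_ideal | apply: idealM => //; exact: maxid_ideal].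
have Bz : B (a * a * y) by apply: ideal_mulr => //; apply: mB.
exists (x + a * a * y); split.
- by apply: idealD => //; exact: maxid_ideal.
- by move=> h'; apply: nBx; rewrite -[x](addrK (a * a * y)); apply: idealB.
move=> t'; rewrite inE mulrDl => /orP[/eqP ->|ht'] Js.
  apply: (prime_notM pp (prime_notM pp na na) ny).
  by rewrite /colon -[_ * t](addKr (x * t)) addrC; apply: idealB.
apply: (hx _ ht'); rewrite -[x * t'](addrK (a * a * y * t')).
by apply: idealB => //; rewrite -mulrA; apply: idealM => //; apply: hy.
Qed.

(** Zero divisors modulo J lie in maximal annihilators, and there are finitely many
of these: take ts such that J + (ts) contains all s with (J : s) maximal; then
(J : s) contains the intersection of the (J : t), hence one of them, hence equals
it. It remains to avoid the (J : t). *)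
Lemma regular_element_exists :
  exists x, [/\ mm x, ~ B x & forall h, J (x * h) -> J h].
Proof.
pose span := foldr (fun s K => adjoin K s) J.
have span_ideal ts : is_ideal (span ts).
  by elim: ts => //= t ts; apply: adjoin_ideal.
have [||_ [[ts [hts ->]] tsmax]] := @noetherian_max _ noeth (fun K =>
  exists ts, (forall t, t \in ts -> maximal_annihilator J t) /\ K = span ts).
- by move=> _ [ts [_ ->]].
- by exists J, [::].
have spanned s : maximal_annihilator J s -> span ts s.
  move=> hs; apply: (tsmax (span (s :: ts))); first last.
  - exact: mem_adjoin.
  - exact: sub_adjoin.
  exists (s :: ts); split=> // t; rewrite inE => /orP[/eqP ->|/hts] //.
have [x [mx nBx hx]] := avoid_annihilators hts.
exists x; split=> // h Jxh; apply: contrapT => nJh.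
have [s [smax /(_ x Jxh) Jxs]] := maximal_annihilator_exists noeth hJ nJh.
have pp := maximal_annihilator_prime hJ smax.
have [|y [ny hy]] := @product_avoiding (colon J s) ts pp.
  move=> t ht /(hts t ht).2 le; apply: (hx t ht); apply: le Jxs.
  by case: smax.
apply: ny; rewrite /colon; move: (spanned s smax) hy.
elim: ts s {smax Jxs pp tsmax hts hx spanned} => [|t ts IH] s /=; first by move=> Js _; apply: idealM.
move=> [a [b [/IH Jb ->]]] hy; rewrite mulrDr mulrCA; apply: idealD => //.
  by apply: idealM => //; apply/hy/mem_head.
by apply: Jb => t' ht'; apply: hy; rewrite inE ht' orbT.
Qed.

End PrimeAvoidance.

(** Ideals generated by n elements of m that form a regular sequence and are
linearly independent modulo the square of m; the ideal B containing J and all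
products a * b witnesses the independence of x. *)
Inductive regular_ideal : nat -> (R -> Prop) -> Prop :=
| regular_ideal0 : regular_ideal 0%N (@zero_ideal R)
| regular_idealS n J x B : regular_ideal n J -> mm x ->
    (forall h, J (x * h) -> J h) ->
    is_ideal B -> ideal_le J B -> (forall a b, mm a -> mm b -> B (a * b)) -> ~ B x ->
    regular_ideal n.+1 (adjoin J x).

Lemma regular_idealP n J : regular_ideal n J -> is_ideal J /\ ideal_le J mm.
Proof.
elim=> [|{}n {}J x B _ [hJ Jm] mx _ _ _ _ _].
  split; first exact: zero_idealP.
  by move=> _ ->; apply: ideal0; exact: maxid_ideal.
split; first exact: adjoin_ideal.
by apply: adjoin_sub => //; exact: maxid_ideal.
Qed.

(** Descend from q one element of the sequence at a time. As x is regular modulo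
J, no product x^k u with u outside q is in J, so some prime containing J avoids
these products: it is contained in q and misses x. *)
Lemma regular_ideal_chain n J q : regular_ideal n J -> is_prime q ->
  ideal_le J q -> exists c, chain_of_primes n c /\ c n = q.
Proof.
move=> rJ; elim: rJ q => [|{}n {}J x B rJ IH mx xreg _ _ _ _] q qp Jq.
  by exists (fun=> q); split=> //; split=> // i; rewrite leqn0 => /eqP ->.
have [hJ _] := regular_idealP rJ; have [hq q1 qM] := qp.
have regX k h : J (x ^+ k * h) -> J h.
  by elim: k h => [|k IHk] h; rewrite ?expr0 ?mul1r // exprS -mulrA => /xreg /IHk.
have [||||p [pp Jp pS]] := @exists_prime_avoiding _ noeth J
    (fun s => exists k u, ~ q u /\ s = x ^+ k * u) => //.
- by exists 0%N, 1; rewrite mul1r.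
- move=> _ _ [k [u [nu ->]]] [k' [u' [nu' ->]]].
  by exists (k + k')%N, (u * u'); split; [exact: prime_notM | rewrite exprD; ring].
- move=> s Js [k [u [nu e]]]; apply: nu; apply/Jq/sub_adjoin/(regX k).
  by rewrite -e.
have pq : ideal_le p q.
  move=> y py; apply: contrapT => nqy; apply: (pS _ py).
  by exists 0%N, y; rewrite mul1r.
have npx : ~ p x by move=> /pS; apply; exists 1%N, 1; rewrite mulr1.
have [c [[cp cs] cn]] := IH p pp Jp.
exists (fun i => if (i <= n)%N then c i else q); rewrite ltnn; split=> //.
split=> i hi; first by case: ifP => // il; apply: cp.
rewrite ltnS in hi; rewrite hi; case: ifP => il; first exact: cs.
have -> : i = n by lia.
by rewrite cn; split=> // /(_ x) h; apply/npx/h/Jq/mem_adjoin.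
Qed.

Lemma regular_ideal_generators n J : regular_ideal n J ->
  exists g : 'I_n -> R, forall x, J x <-> exists c : 'I_n -> R, x = \sum_i c i * g i.
Proof.
elim=> [|{}n {}J x B _ [g hg] _ _ _ _ _ _].
  exists (fun=> 0) => x; split=> [->|[c ->]]; last by rewrite big_ord0.
  by exists (fun=> 0); rewrite big_ord0.
exists (fun i => if unlift ord0 i is Some j then g j else x) => z.
split=> [[a [b [/hg[c ->] ->]]]|[c ->]].
  exists (fun i => if unlift ord0 i is Some j then c j else a).
  by rewrite big_ord_recl unlift_none; under [in RHS]eq_bigr do rewrite liftK.
rewrite big_ord_recl unlift_none; under eq_bigr do rewrite liftK.
by exists (c ord0), (\sum_i c (lift ord0 i) * g i); split=> //; apply/hg; eexists.
Qed.

(** The last prime of the chain may be replaced by m, which is minimal over the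
generators g. *)
Lemma prime_chain_le (n l : nat) (g : 'I_n -> R) (p : 'I_l.+1 -> ideal R) :
  generates g m -> prime_chain p -> (l <= n)%N.
Proof.
move=> gm [pp ps].
have isp i : is_prime (fun x => x \in p i).
  by have [/negP n1 pM] := pp i; split=> //; exact: ideal_of_submodule.
pose c i : R -> Prop := if (i < l)%N then (fun x => is_true (x \in p (inord i))) else mm.
have cl : c l = mm by rewrite /c ltnn.
have ple i : ideal_le (fun x => x \in p i) mm.
  by apply: proper_sub_maxid; case: (isp i).
have lt i : (i < l)%N -> ideal_lt (fun x => x \in p (inord i))
    (fun x => x \in p (inord i.+1)).
  by move=> il; apply: ps; rewrite !inordK // ltnS // ltnW.
rewrite -[n]card_ord -(size_codom g).
apply: (@krull_height _ noeth (codom g) (@zero_ideal R) mm l c) => //.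
- exact: zero_idealP.
- split=> i il; rewrite /c; first by case: ifP => // _; exact: maxid_prime.
  rewrite il; case: ifP => _; first exact: lt.
  have [l1 l2] := lt i il; split; first by move=> x /l1 /ple.
  by move=> h; apply: l2 => x /ple /h.
- move=> _ ->; apply: (@ideal0 _ (c 0%N)); rewrite /c.
  by case: ifP => _; [exact: ideal_of_submodule | exact: maxid_ideal].
- by move=> x /codomP[i ->]; exact: generator_mem.
move=> q [hq _ _] _ gq _ x /gm[d ->]; apply: ideal_sum => // i.
by apply: idealM => //; apply/gq/codom_f.
Qed.

(** The n generators give a chain of primes of length n below m. By
[prime_chain_le] no chain is longer, and the same bound applied to this chain
shows that m needs n generators. *)
Lemma regular_ideal_max n J : regular_ideal n J -> ideal_le mm J -> regular_local m.
Proof.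
move=> rJ mJ; have [hJ Jm] := regular_idealP rJ.
have [g hg] := regular_ideal_generators rJ.
have gm : generates g m.
  by move=> x; split=> [/mJ /hg //|/hg /Jm].
have [c [[cp cs] _]] := regular_ideal_chain rJ maxid_prime Jm.
have ci (i : 'I_n.+1) : is_ideal (c i) by case: (cp i); rewrite // -ltnS.
have pc : prime_chain (fun i => to_ideal (ci i)).
  split=> [i|i j ij].
    have [|_ c1 cM] := cp i; first by rewrite -ltnS.
    split; first by apply/negP => /(in_to_ideal (ci i)) /c1.
    by move=> a b /(in_to_ideal (ci i)) /cM[] h; [left | right]; apply/in_to_ideal.
  have mono k : (k <= n)%N -> (i < k)%N -> ideal_lt (c i) (c k).
    elim: k => // k IH kn; rewrite ltnS leq_eqVlt => /orP[/eqP ->|ik]; first exact: cs.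
    have [l1 l2] := cs k kn; have [l3 l4] := IH (ltnW kn) ik.
    by split=> [x /l3 /l1 //|h]; apply: l4 => x /l1 /h.
  have [|l1 l2] := mono j _ ij; first by rewrite -ltnS.
  split; first by move=> x /(in_to_ideal (ci i)) /l1 h; exact/(in_to_ideal (ci j)).
  by move=> h; apply: l2 => x hx; apply/(in_to_ideal (ci i))/h/(in_to_ideal (ci j)).
exists n; split; first split.
- by eexists; exact: pc.
- by move=> l p; apply: prime_chain_le.
split; first by exists g.
by move=> l g' gm'; apply: prime_chain_le pc.
Qed.

(** Take J maximal among the regular ideals; J <> m as R is singular. For B as in
[nakayama_square], no element of m outside B is regular modulo J, so by
[regular_element_exists] some nonzero element of R / J is killed by m. *)
Lemma singular_socle : ~ regular_local m -> exists n J s,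
  [/\ regular_ideal n J, mm s, ~ J s & forall a, mm a -> J (a * s)].
Proof.
move=> sing.
have [||J [[n rJ] Jmax]] := @noetherian_max _ noeth (fun J => exists n, regular_ideal n J).
- by move=> J [n /regular_idealP[]].
- by exists (@zero_ideal R), 0%N; exact: regular_ideal0.
have [hJ Jm] := regular_idealP rJ.
have nmJ : ~ ideal_le mm J by move=> /(regular_ideal_max rJ).
apply: contrapT => nos.
have [B [hB JB mB nmB]] := nakayama_square hJ nmJ Jm.
have [|x [mx nBx xreg]] := @regular_element_exists J hJ _ B hB mB nmB.
  move=> s nJs; apply: contrapT => na.
  have sJ a : mm a -> J (a * s) by move=> ma; apply: contrapT => h; apply: na; exists a.
  have [ms|nms] := pselect (mm s); first by apply: nos; exists n, J, s.
  apply: nmJ => a /sJ; rewrite mulrC; exact: cancel_unit.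
apply: (nBx); apply: (JB); apply: (Jmax (adjoin J x)); first last.
- exact: mem_adjoin.
- exact: sub_adjoin.
by exists n.+1; exact: (regular_idealS rJ mx xreg hB JB mB nBx).
Qed.

End LocalRing.

(** * Cocycles of the minimal resolution of the residue field *)

Section MinimalResolution.
Variables (R : comNzRingType) (m : ideal R).
Hypotheses (noeth : noetherian R) (m_local : is_local m).
Implicit Types (J B : R -> Prop).

Let mm : R -> Prop := fun x => x \in m.
Let hm : is_ideal mm := maxid_ideal m.

Definition entries J (p q : nat) (A : 'M[R]_(p, q)) := forall i j, J (A i j).

Lemma entriesD J p q (A B : 'M_(p, q)) : is_ideal J ->
  entries J A -> entries J B -> entries J (A + B).
Proof. by move=> hJ hA hB i j; rewrite mxE; apply: idealD. Qed.

Lemma entriesB J p q (A B : 'M_(p, q)) : is_ideal J ->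
  entries J A -> entries J B -> entries J (A - B).
Proof. by move=> hJ hA hB i j; rewrite !mxE; apply: idealB. Qed.

Lemma entriesZ J p q a (A : 'M_(p, q)) : is_ideal J -> J a -> entries J (a *: A).
Proof. by move=> hJ ha i j; rewrite mxE; apply: ideal_mulr. Qed.

Lemma entriesM J p q r (A : 'M_(p, q)) (B : 'M_(q, r)) : is_ideal J ->
  entries J A -> entries J (A *m B).
Proof.
by move=> hJ hA i j; rewrite mxE; apply: ideal_sum => // k; apply: ideal_mulr.
Qed.

Lemma entries_mulmx J p q r (A : 'M_(p, q)) (B : 'M_(q, r)) : is_ideal J ->
  entries J B -> entries J (A *m B).
Proof.
by move=> hJ hB i j; rewrite mxE; apply: ideal_sum => // k; apply: idealM.
Qed.

Variables (b : nat -> nat) (D : forall n, 'M[R]_(b n.+1, b n)).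

(** The complex of the row spaces of size b n, with D n acting by multiplication
on the right. The cokernel of D 0 is a direct sum of copies of k, of which there
is one when b 0 = 1. *)
Record minimal_resolution : Prop := MinimalResolution {
  minres_entries : forall n, entries mm (D n);
  minres_comp : forall n, D n.+1 *m D n = 0;
  minres_aug : forall v : 'rV_(b 0%N), entries mm v -> exists w, v = w *m D 0%N;
  minres_exact : forall n (v : 'rV_(b n.+1)), v *m D n = 0 ->
    exists w, v = w *m D n.+1
}.

Hypothesis res : minimal_resolution.

(** For n = 0 the condition is empty, as the complex ends there. *)
Definition cycle_mod J n : 'rV[R]_(b n) -> Prop :=
  match n with
  | 0 => fun=> True
  | k.+1 => fun g => entries J (g *m D k)
  end.

Lemma adjoin_entries J x p q (A : 'M[R]_(p, q)) : entries (adjoin J x) A ->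
  exists H K : 'M_(p, q), entries J K /\ A = x *: H + K.
Proof.
move=> hA.
have [f hf] := choice (fun ij : 'I_p * 'I_q => hA ij.1 ij.2).
have [g hg] := choice hf.
exists (\matrix_(i, j) f (i, j)), (\matrix_(i, j) g (i, j)); split.
  by move=> i j; rewrite mxE; case: (hg (i, j)).
by apply/matrixP => i j; rewrite !mxE; case: (hg (i, j)) => _ /= ->; rewrite mulrC.
Qed.

(** Injectivity of Tor_n(k, R / J) -> Tor_n(k, k), by induction along the regular
sequence. For J' = J + R x write g D = x h + j with j in J. Since x is regular
modulo J, h is a cycle modulo J. Since g and D have entries in m, those of x h lie
in B, and as x does not, h has entries in m. So h is a boundary y D modulo J, and
g - x y is a cycle modulo J with entries in m, hence again a boundary. *)
Lemma regular_ideal_cycles k J : regular_ideal m k J ->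
  forall n (g : 'rV_(b n)), entries mm g -> cycle_mod J g ->
  exists y, entries J (g - y *m D n).
Proof.
elim=> [|{}k {}J x B rJ IH mx xreg hB JB mB nBx] n g mg cg.
  case: n g mg cg => [|n] g mg cg.
    have [w ->] := minres_aug res mg.
    by exists w => i j; rewrite subrr mxE.
  have [|w ->] := minres_exact res (v := g).
    by apply/matrixP => i j; rewrite cg mxE.
  by exists w => i j; rewrite subrr mxE.
have [hJ Jm] := regular_idealP rJ.
have hJx := adjoin_ideal x hJ.
case: n g mg cg => [|n] g mg cg.
  have [w ->] := minres_aug res mg.
  by exists w => i j; rewrite subrr mxE; exact: ideal0.
have [h [j [Jj e]]] := adjoin_entries cg.
have cyc_h : cycle_mod J h.
  case: n g h j mg cg Jj e => [//|n] g h j mg cg Jj e /=.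
  have e0 : x *: (h *m D n) = - (j *m D n).
    apply/eqP; rewrite -addr_eq0 scalemxAl -mulmxDl -e -mulmxA.
    by rewrite (minres_comp res) mulmx0.
  move=> i i'; apply: xreg.
  have -> : x * (h *m D n) i i' = (x *: (h *m D n)) i i' by rewrite [RHS]mxE.
  by rewrite e0 mxE; apply: idealN => //; apply: entriesM.
have mh : entries mm h.
  move=> i i'; apply: contrapT => nmh; apply: nBx.
  apply: (cancel_unit noeth m_local hB nmh).
  have -> : h i i' * x = (g *m D n) i i' - j i i'.
    by rewrite e [RHS]/= !mxE addrK mulrC.
  apply: idealB => //; last exact: JB.
  rewrite mxE; apply: ideal_sum => // l; apply: mB; first exact: mg.
  exact: minres_entries.
have [y hy] := IH n h mh cyc_h.
have [||w hw] := IH n.+1 (g - x *: y).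
- by apply: entriesB => //; apply: entriesZ.
- rewrite /= mulmxBl e -scalemxAl addrAC -scalerBr.
  apply: entriesD => //.
  by move=> i i'; rewrite mxE; apply: idealM.
exists w => i i'.
have -> : (g - w *m D n.+1) i i' = x * y i i' + (g - x *: y - w *m D n.+1) i i'.
  by rewrite !mxE; ring.
apply: idealD => //; last exact: sub_adjoin.
by apply: ideal_mulr => //; apply: mem_adjoin.
Qed.

(** For the socle element s and the basis vector e_i, the row s e_i is a cycle
modulo J with entries in m, hence a boundary modulo J, and a kills boundaries; so
a_i s is in J. *)
Lemma cocycle_entries : ~ regular_local m ->
  forall n (a : 'cV_(b n)), D n *m a = 0 -> entries mm a.
Proof.
move=> /(singular_socle noeth m_local)[k [J [s [rJ ms nJs sJ]]]] n a Da i j.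
have [hJ Jm] := regular_idealP rJ.
apply: contrapT => nma; apply: nJs; apply: (cancel_unit noeth m_local hJ nma).
pose e : 'rV[R]_(b n) := delta_mx 0 i.
have [||y hy] := regular_ideal_cycles rJ (g := s *: e).
- exact: entriesZ.
- rewrite /e; case: n a i {Da nma e} => [//|n] a i /= p q.
  rewrite -scalemxAl mxE mulrC; apply: sJ.
  exact: (entries_mulmx (delta_mx 0 i) hm (minres_entries res (n:=n))).
have -> : a i j * s = ((s *: e - y *m D n) *m a) 0 j.
  by rewrite mulmxBl -mulmxA Da mulmx0 subr0 -scalemxAl mxE -rowE mxE mulrC.
exact: entriesM.
Qed.

End MinimalResolution.

(** * Chain maps that vanish in high degrees *)

Section BoundedChainMaps.
Variables (R : comNzRingType) (m : ideal R).
Variables (b : nat -> nat) (D : forall n, 'M[R]_(b n.+1, b n)).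
Hypothesis res : minimal_resolution m D.

Let mm : R -> Prop := fun x => x \in m.
Let hm : is_ideal mm := maxid_ideal m.

Lemma lift_cycles p n (A : 'M_(p, b n.+1)) : A *m D n = 0 ->
  exists B, A = B *m D n.+1.
Proof.
move=> AD.
have rowP i : exists w, row i A = w *m D n.+1.
  by apply: (minres_exact res); rewrite -row_mul AD row0.
have [w hw] := choice rowP.
exists (\matrix_i w i); apply/row_matrixP => i.
by rewrite hw row_mul rowK.
Qed.

Lemma lift_entries p (A : 'M_(p, b 0%N)) : entries mm A -> exists B, A = B *m D 0%N.
Proof.
move=> mA.
have rowP i : exists w, row i A = w *m D 0%N.
  by apply: (minres_aug res) => i0 j; rewrite mxE; exact: mA.
have [w hw] := choice rowP.
exists (\matrix_i w i); apply/row_matrixP => i.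
by rewrite hw row_mul rowK.
Qed.

(** A graded map of degree i is encoded by a family of which only the members with
k = j + i matter; this spares casts between b (j + i).+1 and b (j + i.+1). *)
Definition family := forall j k, 'M[R]_(b j, b k).

(** A chain map G -> G that raises degrees by i, up to the sign e, is null-homotopic
as soon as its component in degree 0 consists of boundaries; for i > 0 this is
automatic for cycles, since G is exact there. *)
Lemma null_homotopy i (e : R) (phi : family) : e * e = 1 ->
  (forall j k, k = (j + i)%N ->
    phi j.+1 k.+1 *m D k = e *: (D j *m phi j k)) ->
  (exists B, phi 0%N i = B *m D i) ->
  exists h : family, phi 0%N i = e *: (h 0%N i.+1 *m D i) /\
    forall j k, k = (j + i)%N ->
    phi j.+1 k.+1 = D j *m h j k.+1 + e *: (h j.+1 k.+2 *m D k.+1).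
Proof.
move=> ee phiD [B0 phi0].
have [||h [hP hQ]] := @dependent_choice_nat (fun j => forall k, 'M[R]_(b j, b k))
  (fun j h => D j *m (e *: phi j (j + i)%N - h (j + i).+1%N *m D (j + i)%N) = 0 /\
    (j = 0%N -> phi j (j + i)%N = e *: (h (j + i).+1%N *m D (j + i)%N)))
  (fun j h h' => phi j.+1 (j + i).+1%N =
    D j *m h (j + i).+1%N + e *: (h' (j + i).+2%N *m D (j + i).+1%N)).
- exists (fun k => conform_mx 0 (e *: B0)); rewrite conform_mx_id.
  have e0 : phi 0%N i = e *: (e *: B0 *m D i).
    by rewrite -scalemxAl scalerA ee scale1r.
  by split=> //; rewrite -[phi 0%N _]/(phi 0%N i) e0 scalerA ee scale1r subrr mulmx0.
- move=> j h [hP _].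
  have [B hB] : exists B, phi j.+1 (j + i).+1%N - D j *m h (j + i).+1%N =
      B *m D (j + i).+1%N.
    apply: lift_cycles; rewrite mulmxBl phiD // -mulmxA.
    by rewrite scalemxAr -mulmxBr.
  exists (fun k => conform_mx 0 (e *: B)); rewrite conform_mx_id.
  have hh : phi j.+1 (j + i).+1%N =
      D j *m h (j + i).+1%N + e *: (e *: B *m D (j + i).+1%N).
    by rewrite -scalemxAl scalerA ee scale1r -hB addrC subrK.
  split=> //; split=> //.
  rewrite -[(j.+1 + i)%N]/((j + i).+1)%N hh scalerDr scalerA ee scale1r addrK.
  by rewrite -scalemxAr mulmxA (minres_comp res) mul0mx scaler0.
exists h; split; first by case: (hP 0%N) => _; apply.
by move=> j _ ->.
Qed.

Section Correction.
Variables (l : nat) (q : 'I_(b l)).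

(** A family W c p indexed by the basis of G_c represents the map sum_p W c p (x) b_p
from G to G (x) G_c; [contract] is its composite with id (x) D. *)
Definition contract (W : forall c, 'I_(b c) -> family) c (p' : 'I_(b c)) : family :=
  fun j k => \sum_p D c p p' *: W c.+1 p j k.

Lemma contract_contract (W : forall c, 'I_(b c) -> family) c (p : 'I_(b c)) j k :
  \sum_p' D c p' p *: contract W p' j k = 0.
Proof.
rewrite /contract; under eq_bigr do rewrite scaler_sumr.
rewrite exchange_big /= big1 // => r _.
under eq_bigr do rewrite scalerA.
rewrite -scaler_suml.
have -> : \sum_p' D c p' p * D c.+1 r p' = (D c.+1 *m D c) r p.
  by rewrite mxE; apply: eq_bigr => p' _; rewrite mulrC.
by rewrite (minres_comp res) mxE scale0r.
Qed.

(** The components W i : G -> G (x) G_(l-i) of a chain map G -> G (x) G starting with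
id (x) b_q. Given W i, the composite of W i with id (x) D is a chain map up to
sign, and W (i+1) is a null-homotopy of it. For i = 0 it is a sum of multiples of
the identity by entries of D, which lie in m; multiplication by an element of m is
null-homotopic on G. *)
Lemma tensor_lift : exists W : forall i c, 'I_(b c) -> family,
  (forall p j, W 0 l p j j = (p == q)%:R%:M) /\
  forall i c, (c.+1 + i = l)%N -> forall (p' : 'I_(b c)) j k, k = (j + i)%N ->
    contract (W i) p' j.+1 k.+1 = D j *m W i.+1 c p' j k.+1 +
      (-1) ^+ i *: (W i.+1 c p' j.+1 k.+2 *m D k.+1).
Proof.
pose T (i : nat) := forall c, 'I_(b c) -> family.
pose W0 : T 0%N := fun c p j k =>
  ((p : nat) == q)%:R *: \matrix_(x, y) ((x : nat) == y)%:R.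
have W0E c (p : 'I_(b c)) j : W0 c p j j = ((p : nat) == q)%:R%:M.
  rewrite /W0 -scalemx1; congr (_ *: _); apply/matrixP => x y.
  by rewrite !mxE.
pose chain i (W : T i) := forall c, (c.+1 + i = l)%N -> forall p' : 'I_(b c),
  (forall j k, k = (j + i)%N -> contract W p' j.+1 k.+1 *m D k =
     (-1) ^+ i *: (D j *m contract W p' j k)) /\
  exists B, contract W p' 0%N i = B *m D i.
pose homotopy i (W W' : T i) := forall c, (c.+1 + i = l)%N ->
  forall p' : 'I_(b c), contract W p' 0%N i = (-1) ^+ i *: (W' c p' 0%N i.+1 *m D i) /\
    forall j k, k = (j + i)%N -> contract W p' j.+1 k.+1 =
      D j *m W' c p' j k.+1 + (-1) ^+ i *: (W' c p' j.+1 k.+2 *m D k.+1).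
have sgn i : (-1) ^+ i * (-1) ^+ i = 1 :> R.
  by rewrite -exprD addnn -mul2n exprM sqrrN !expr1n.
have chain0 : chain 0%N W0.
  move=> c; rewrite addn0 => cl p'.
  have E j : contract W0 p' j j =
      (\sum_(p < b c.+1) D c p p' * ((p : nat) == q)%:R)%:M.
    rewrite /contract; under eq_bigr do rewrite W0E scale_scalar_mx.
    by rewrite raddf_sum.
  split=> [j k|].
    rewrite addn0 => ->.
    by rewrite !E expr0 scale1r scalar_mxC.
  apply: lift_entries; rewrite E => i j; rewrite mxE.
  have mc : mm (\sum_(p < b c.+1) D c p p' * ((p : nat) == q)%:R).
    apply: ideal_sum => // p; apply: ideal_mulr => //.
    exact: (minres_entries res).
  by case: (i == j); rewrite ?mulr1n ?mulr0n //; exact: ideal0.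
have step i (W : T i) : chain i W ->
    exists W' : T i.+1, chain i.+1 W' /\ homotopy i W W'.
  move=> cW.
  have ex c (p' : 'I_(b c)) : exists h : family, (c.+1 + i = l)%N ->
     contract W p' 0%N i = (-1) ^+ i *: (h 0%N i.+1 *m D i) /\
     forall j k, k = (j + i)%N -> contract W p' j.+1 k.+1 =
      D j *m h j k.+1 + (-1) ^+ i *: (h j.+1 k.+2 *m D k.+1).
    have [cl|ncl] := pselect (c.+1 + i = l)%N; last by exists (fun _ _ => 0) => /ncl.
    have [c1 c2] := cW c cl p'.
    by have [h hh] := null_homotopy (sgn i) c1 c2; exists h.
  pose W' : T i.+1 := fun c p' => sval (cid (ex c p')).
  have hW' : homotopy i W W' by move=> c cl p'; exact: (svalP (cid (ex c p'))) cl.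
  exists W'; split=> // c cl p''.
  have cl' : (c.+2 + i = l)%N by rewrite -cl addnS.
  split=> [j k -> {k}|].
    rewrite addnS.
    have E p : W' c.+1 p j.+1 (j + i).+2%N *m D (j + i).+1%N = (-1) ^+ i *:
        contract W p j.+1 (j + i).+1%N -
        (-1) ^+ i *: (D j *m W' c.+1 p j (j + i).+1%N).
      rewrite ((hW' c.+1 cl' p).2 j _ erefl).
      by rewrite scalerDr scalerA sgn scale1r [_ + _ *m _]addrC addrK.
    rewrite {1}/contract mulmx_suml.
    under eq_bigr do rewrite -scalemxAl E scalerBr !scalerA
      [_ * (-1) ^+ i]mulrC -!scalerA.
    rewrite sumrB -!scaler_sumr contract_contract scaler0 sub0r.
    rewrite exprS mulN1r scaleNr; congr (- (_ *: _)).
    by rewrite /contract mulmx_sumr; apply: eq_bigr => p _; rewrite scalemxAr.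
  apply: lift_cycles; rewrite {1}/contract mulmx_suml.
  have E p : W' c.+1 p 0%N i.+1 *m D i = (-1) ^+ i *: contract W p 0%N i.
    by rewrite ((hW' c.+1 cl' p).1) scalerA sgn scale1r.
  under eq_bigr do rewrite -scalemxAl E scalerA [_ * (-1) ^+ i]mulrC -scalerA.
  by rewrite -scaler_sumr contract_contract scaler0.
have [||W [WP WQ]] := @dependent_choice_nat T
  (fun i W => chain i W /\ (i = 0%N -> forall p j, W l p j j = (p == q)%:R%:M)) homotopy.
- by exists W0; split.
- by move=> i W [/step[W' [cW' hW']] _]; exists W'.
exists W; split; first by case: (WP 0%N) => _; apply.
by move=> i c cl p' j k jk; case: (WQ i c cl p') => _; apply.
Qed.

(** The composite of [tensor_lift] with a (x) 1, whose component G_(c+n) -> G_c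
only involves W (l - c). The homotopy terms ending in the image of D are killed
by a, which makes the composite a chain map; every component factors through a. *)
Lemma chain_correction n (a : 'cV_(b (l + n))) :
  D (l + n) *m a = 0 -> entries mm a ->
  exists Psi : forall c, 'M[R]_(b (c + n), b c),
  [/\ forall c, Psi c.+1 *m D c = D (c + n) *m Psi c,
      forall c, entries mm (Psi c), forall c, (l < c)%N -> Psi c = 0 &
      Psi l = a *m delta_mx 0 q].
Proof.
move=> Da ma; have [W [W0 WS]] := tensor_lift.
pose X c : 'M[R]_(b (c + n), b c) := if (c <= l)%N then
  \matrix_(g, p) (W (l - c)%N c p (c + n)%N (l + n)%N *m a) g 0 else 0.
have XS c : (c < l)%N -> X c.+1 *m D c = D (c + n) *m X c.
  move=> cl; rewrite /X cl (ltnW cl).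
  have -> : (l - c)%N = (l - c.+1).+1 by lia.
  set i := (l - c.+1)%N; have cil : (c.+1 + i = l)%N by rewrite /i; lia.
  apply/matrixP => g p'.
  have := WS i c cil p' (c + n)%N (c + n + i)%N erefl.
  have -> : (c + n + i).+1 = (l + n)%N by lia.
  move=> /(congr1 (fun A => (A *m a) g 0)) E.
  transitivity ((contract (W i) p' (c + n).+1 (l + n)%N *m a) g 0).
    rewrite /contract mulmx_suml summxE mxE; apply: eq_bigr => p _.
    by rewrite mxE -scalemxAl [RHS]mxE mulrC.
  rewrite E mulmxDl -scalemxAl -[_ *m D (l + n) *m a]mulmxA Da mulmx0 scaler0 addr0.
  rewrite -mulmxA !mxE; apply: eq_bigr => h _.
  by rewrite [in RHS]mxE.
have Xl : X l = a *m delta_mx 0 q.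
  apply/matrixP => g p; rewrite /X leqnn subnn mxE W0 mul_scalar_mx !mxE.
  by rewrite big_ord1 !mxE mulrC.
exists X; split=> //.
- move=> c; case: (ltngtP c l) => [cl|lc|->]; first exact: XS.
    have -> : X c.+1 = 0 by rewrite /X leqNgt (leqW lc).
    have -> : X c = 0 by rewrite /X leqNgt lc.
    by rewrite mul0mx mulmx0.
  by rewrite Xl mulmxA Da mul0mx /X ltnn mul0mx.
- move=> c; rewrite /X; case: ifP => _ g p; last by rewrite mxE; exact: ideal0.
  rewrite mxE; exact: (entries_mulmx _ hm ma).
- by move=> c lc; rewrite /X leqNgt lc.
Qed.

End Correction.

Hypothesis cocycles_minimal :
  forall n (a : 'cV_(b n)), D n *m a = 0 -> entries mm a.

(** Induction on the top degree: the columns of Psi l are cocycles, and the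
corrections they give remove Psi l without changing Psi 0 modulo m. *)
Lemma bounded_chain_map_minimal l n (Psi : forall c, 'M[R]_(b (c + n), b c)) :
  (forall c, Psi c.+1 *m D c = D (c + n) *m Psi c) ->
  (forall c, (l < c)%N -> Psi c = 0) -> entries mm (Psi 0%N).
Proof.
elim: l Psi => [|l IH] Psi PsiD Psi0.
  move=> i j; have /(_ i 0) : entries mm (col j (Psi 0%N)).
    apply: cocycles_minimal; rewrite -[D n]/(D (0 + n)) colE mulmxA -PsiD Psi0 //.
    by rewrite !mul0mx.
  by rewrite mxE.
have DP : D (l.+1 + n) *m Psi l.+1 = 0 by rewrite -PsiD Psi0 // mul0mx.
have Dcol q : D (l.+1 + n) *m col q (Psi l.+1) = 0.
  by rewrite colE mulmxA DP mul0mx.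
have [X hX] := choice (fun q => chain_correction q (Dcol q) (cocycles_minimal (Dcol q))).
pose Y c := \sum_q X q c.
have YD c : Y c.+1 *m D c = D (c + n) *m Y c.
  rewrite /Y mulmx_suml mulmx_sumr; apply: eq_bigr => q _.
  by case: (hX q).
have mY : entries mm (Y 0%N).
  move=> i j; rewrite /Y summxE; apply: ideal_sum => // q.
  by case: (hX q) => _ + _ _; apply.
suff : entries mm (Psi 0%N - Y 0%N).
  by move=> h; rewrite -[Psi 0%N](subrK (Y 0%N)); apply: entriesD.
apply: (IH (fun c => Psi c - Y c)) => [c|c].
  by rewrite mulmxBl mulmxBr PsiD YD.
rewrite leq_eqVlt => /orP[/eqP <-|lc]; last first.
  rewrite Psi0 // sub0r /Y big1 ?oppr0 // => q _.
  by case: (hX q) => _ _ + _; apply.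
apply/eqP; rewrite subr_eq0; apply/eqP; rewrite /Y.
under eq_bigr => q _ do (case: (hX q) => _ _ _ ->).
apply/matrixP => i j; rewrite summxE (bigD1 j) //= big1 => [|q qj].
  by rewrite !mxE big_ord1 !mxE !eqxx mulr1 addr0.
by rewrite !mxE big_ord1 !mxE [j == q]eq_sym (negPf qj) mulr0.
Qed.

End BoundedChainMaps.

(** * Existence of the minimal resolution *)

Section Existence.
Variables (R : comNzRingType) (m : ideal R).
Hypotheses (noeth : noetherian R) (m_local : is_local m).

Let mm : R -> Prop := fun x => x \in m.

Definition row_submodule n (K : 'rV[R]_n -> Prop) :=
  K 0 /\ forall a u v, K u -> K v -> K (a *: u + v).

Definition spanned_by n (K : 'rV[R]_n -> Prop) p (B : 'M_(p, n)) :=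
  forall v, K v <-> exists w, v = w *m B.

(** The leading entries of the rows in K form an ideal; K is generated by rows
lifting its generators together with generators of the rows of K starting
with 0. *)
Lemma noetherian_rows n (K : 'rV[R]_n -> Prop) : row_submodule K ->
  exists p (B : 'M_(p, n)), spanned_by K B.
Proof.
elim: n K => [|n IH] K.
  case=> K0 _.
  exists 0%N, 0 => v; rewrite [v]thinmx0; split=> // _.
  by exists 0; rewrite mulmx0.
move: K; rewrite -[n.+1]/(1 + n)%N => K [K0 KS].
pose I a := exists v, K v /\ v 0 0 = a.
have hI : is_ideal I.
  split; first by exists 0; rewrite mxE.
  move=> a _ _ [u [Ku <-]] [v [Kv <-]]; exists (a *: u + v).
  by rewrite !mxE; split=> //; apply: KS.
have [k [g hg]] := noeth (to_ideal hI).
have gI i : I (g i) by exact/(in_to_ideal hI)/generator_mem.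
have [u hu] := choice gI.
pose U : 'M_(k, 1 + n) := \matrix_i u i.
have KU w : K (w *m U).
  rewrite mulmx_sum_row; elim/big_ind: _ => // [x y hx hy|i _].
    by rewrite -[x]scale1r; apply: KS.
  by rewrite rowK -[_ *: _]addr0; apply: KS => //; case: (hu i).
have [|q [B hB]] := IH (fun v => K (row_mx (0 : 'rV_1) v)).
  split; first by rewrite row_mx0.
  move=> a v w hv hw; have := KS a _ _ hv hw.
  by rewrite scale_row_mx add_row_mx scaler0 addr0.
exists (k + q)%N, (col_mx U (row_mx 0 B)) => v; split=> [Kv|[w ->]]; last first.
  rewrite -[w]hsubmxK mul_row_col mul_mx_row mulmx0 -[_ *m U]scale1r.
  by apply: KS => //; apply/hB; eexists.
have /hg[c hc] : v 0 0 \in to_ideal hI by apply/in_to_ideal; exists v.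
pose w1 : 'rV_k := \row_i c i.
have e0 : (v - w1 *m U) 0 0 = 0.
  rewrite !mxE hc; apply/eqP; rewrite subr_eq0; apply/eqP/eq_bigr => i _.
  by rewrite !mxE (hu i).2.
have [w2 e2] : exists w2, rsubmx (v - w1 *m U : 'rV_(1 + n)) = w2 *m B.
  apply/hB; suff -> : row_mx 0 (rsubmx (v - w1 *m U : 'rV_(1 + n))) = v - w1 *m U.
    by rewrite addrC -scaleN1r; apply: KS.
  rewrite -[RHS](@hsubmxK _ 1 1 n); congr (row_mx _ _).
  by apply/rowP => i; rewrite !ord1 [LHS]mxE [RHS]mxE -[LHS]e0; congr (_ _ _); apply/val_inj.
exists (row_mx w1 w2); rewrite mul_row_col mul_mx_row mulmx0 -e2.
apply/eqP; rewrite addrC -subr_eq; apply/eqP.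
rewrite -[LHS](@hsubmxK _ 1 1 n); congr (row_mx _ _).
by apply/rowP => i; rewrite !ord1 [RHS]mxE [LHS]mxE -[RHS]e0; congr (_ _ _); apply/val_inj.
Qed.

(** With the least possible number of generators, a relation having a unit
coefficient would allow one of them to be dropped. *)
Lemma minimal_span n (K : 'rV[R]_n -> Prop) : row_submodule K ->
  exists p (B : 'M_(p, n)), spanned_by K B /\
    forall w : 'rV_p, w *m B = 0 -> entries mm w.
Proof.
move=> KK.
have ex : exists p, `[< exists B : 'M_(p, n), spanned_by K B >].
  by have [p [B hB]] := noetherian_rows KK; exists p; apply/asboolP; exists B.
case: (ex_minnP ex) => p /asboolP[B hB] pmin; exists p, B; split=> // w wB i0 i.
rewrite (ord1 i0) {i0}; apply: contrapT => nw.
case: p B hB pmin w wB i nw => [|p] B hB pmin w wB i nw; first by case: i {nw}.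
have [y yw] := unit_notin_maxid noeth m_local nw.
suff /pmin : `[< exists B : 'M_(p, n), spanned_by K B >] by rewrite ltnn.
apply/asboolP; exists (row' i B) => v; split=> [/hB[u ->]|[u ->]].
  exists (\row_j (u - (u 0 i * y) *: w) 0 (lift i j)).
  have -> : u *m B = (u - (u 0 i * y) *: w) *m B.
    by rewrite mulmxBl -scalemxAl wB scaler0 subr0.
  apply/rowP => k; rewrite !mxE (bigD1_ord i) //= !mxE -mulrA yw mulr1 subrr.
  by rewrite mul0r add0r; apply: eq_bigr => j _; rewrite !mxE.
apply/hB; exists (\row_j (if unlift i j is Some j' then u 0 j' else 0)).
apply/rowP => k; rewrite !mxE (bigD1_ord i) //= mxE unlift_none mul0r add0r.
by apply: eq_bigr => j _; rewrite !mxE liftK.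
Qed.

Lemma minimal_kernel q r (A : 'M[R]_(q, r)) : exists s : {p & 'M[R]_(p, q)},
  (forall v : 'rV_q, v *m A = 0 <-> exists w, v = w *m projT2 s) /\
  forall w : 'rV_(projT1 s), w *m projT2 s = 0 -> entries mm w.
Proof.
have [|p [B hB]] := @minimal_span q (fun v => v *m A = 0).
  split; first by rewrite mul0mx.
  by move=> a u v hu hv; rewrite mulmxDl -scalemxAl hu hv scaler0 addr0.
by exists (existT _ p B).
Qed.

(** The rank in degree 0 is definitionally 1, so that row vectors of degree 0 have
an entry v 0 0. *)
Definition ranks (r : nat -> nat) n : nat := if n is k.+1 then r k else 1%N.

Lemma minimal_resolution_exists : exists r (D : forall n, 'M[R]_(ranks r n.+1, ranks r n)),
  minimal_resolution m D.
Proof.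
have [|p0 [D0 [hD0 D0m]]] := @minimal_span 1 (fun v : 'rV_1 => entries mm v).
  split; first by move=> i j; rewrite mxE; exact: ideal0 (maxid_ideal m).
  move=> a u v hu hv i j; rewrite !mxE; have := maxid_ideal m.
  by move=> hm; apply: idealD => //; apply: idealM.
pose next q r (A : 'M[R]_(q, r)) := sval (cid (minimal_kernel A)).
have nextP q r (A : 'M[R]_(q, r)) := svalP (cid (minimal_kernel A)).
(* A state is a matrix together with its two dimensions; the next state is a
   minimal generating matrix of its kernel, so consecutive dimensions agree by
   computation. *)
pose T := {r & {q & 'M[R]_(q, r)}}.
pose fix st n : T := if n is k.+1 then
    existT _ (projT1 (projT2 (st k)))
      (existT _ (projT1 (next _ _ (projT2 (projT2 (st k)))))
         (projT2 (next _ _ (projT2 (projT2 (st k))))))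
  else existT _ 1%N (existT _ p0 D0).
pose r n := projT1 (projT2 (st n)).
pose D n : 'M[R]_(ranks r n.+1, ranks r n) :=
  match n with 0 => D0 | k.+1 => projT2 (projT2 (st k.+1)) end.
have ker n (v : 'rV_(ranks r n.+1)) :
    (v *m D n = 0 <-> exists w, v = w *m D n.+1).
  by case: n v => [|n] v; [exact: (nextP _ _ D0).1 | exact: (nextP _ _ (D n.+1)).1].
have kerm n (w : 'rV_(ranks r n.+1)) : w *m D n = 0 -> entries mm w.
  case: n w => [|n] w; first exact: D0m.
  exact: (nextP _ _ (projT2 (projT2 (st n)))).2.
have comp n : D n.+1 *m D n = 0.
  apply/row_matrixP => i; rewrite row_mul row0; apply/ker.
  by exists (delta_mx 0 i); rewrite rowE.
exists r, D; split=> //.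
- case=> [|n] i j.
    have /hD0/(_ 0 j) : exists w, row i D0 = w *m D0.
      by exists (delta_mx 0 i); rewrite rowE.
    by rewrite mxE.
  have /kerm/(_ 0 j) : row i (D n.+1) *m D n = 0 by rewrite -row_mul comp row0.
  by rewrite mxE.
- by move=> v /hD0.
by move=> n v /ker.
Qed.

End Existence.

(** * Comparison of projective resolutions *)

Section Comparison.
Variable R : comNzRingType.

Lemma linear_pack (A B : lmodType R) (f : A -> B) : linear f ->
  exists g : {linear A -> B}, g =1 f.
Proof.
move=> lf; pose H := GRing.isLinear.Build R A B *:%R f lf.
by pose g : {linear A -> B} := HB.pack f H; exists g.
Qed.

Section Image.
Variables (A B : lmodType R) (d : {linear A -> B}).
Fact image_closed : GRing.submod_closed ([pred y | `[< exists x, d x = y >]] : {pred B}).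
Proof.
split; first by apply/asboolP; exists 0; rewrite linear0.
move=> a _ _ /asboolP[x <-] /asboolP[y <-]; apply/asboolP.
by exists (a *: x + y); rewrite linearP.
Qed.
Definition image_submodule : submodule B := Submodule image_closed.
End Image.

(** Corestrict both maps to the image of d. *)
Lemma projective_lift (P A B : lmodType R) (d : {linear A -> B}) (f : {linear P -> B}) :
  projective P -> (forall x, exists y, d y = f x) ->
  exists h : {linear P -> A}, forall x, d (h x) = f x.
Proof.
move=> projP fd; pose S := image_submodule d.
have dS x : d x \in S by apply/asboolP; exists x.
have fS x : f x \in S by apply/asboolP.
have [|dd ddE] := @linear_pack A (submod S) (fun x => Sub (d x) (dS x)).
  by move=> a x y; apply/val_inj; rewrite /= linearP.
have [|ff ffE] := @linear_pack P (submod S) (fun x => Sub (f x) (fS x)).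
  by move=> a x y; apply/val_inj; rewrite /= linearP.
have [b|h hh] := projP _ _ dd ff.
  have /asboolP[x xb] := valP b; exists x; rewrite ddE.
  exact/val_inj.
by exists h => x; have := congr1 val (hh x); rewrite ddE ffE.
Qed.

Lemma projective_rows n : projective 'rV[R]_n.
Proof.
move=> A B g f g_surj.
have [a ha] := choice (fun i => g_surj (f (delta_mx 0 i))).
have [|h hE] := @linear_pack 'rV[R]_n A (fun v => \sum_i v 0 i *: a i).
  move=> c u v; rewrite scaler_sumr -big_split /=; apply: eq_bigr => i _.
  by rewrite !mxE scalerDl scalerA.
exists h => v; rewrite hE linear_sum [in RHS](row_sum_delta v) linear_sum.
by apply: eq_bigr => i _; rewrite !linearZ /= ha.
Qed.

(** X need not be exact: it will also be a shifted part of a resolution, or a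
resolution of another module mapped to N. *)
Lemma comparison (N : lmodType R) (X : nat -> lmodType R)
    (dX : forall n, {linear X n.+1 -> X n}) (eps : {linear X 0%N -> N})
    (Q : proj_resolution N) :
  (forall n, projective (X n)) -> (forall x, eps (dX 0%N x) = 0) ->
  (forall n x, dX n (dX n.+1 x) = 0) ->
  exists phi : forall n, {linear X n -> Q n},
    (forall x, res_aug Q (phi 0%N x) = eps x) /\
    forall n x, res_diff Q n (phi n.+1 x) = phi n (dX n x).
Proof.
move=> projX epsd dd.
have [||phi [phiP phiQ]] := @dependent_choice_nat (fun n => {linear X n -> Q n})
  (fun n f => (forall x, exists y, res_diff Q n y = f (dX n x)) /\
     match n return {linear X n -> Q n} -> Prop with
     | 0 => fun f => forall x, res_aug Q (f x) = eps x
     | _ => fun=> True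
     end f)
  (fun n f g => forall x, res_diff Q n (g x) = f (dX n x)).
- have [|f hf] := @projective_lift _ _ _ (res_aug Q) eps (projX 0).
    by move=> x; exact: res_aug_surj.
  exists f; split=> // x.
  by have /res_exact0[y ->] : res_aug Q (f (dX 0%N x)) = 0; [rewrite hf | exists y].
- move=> n f [hf _].
  have [|g hg] := @projective_lift _ _ _ (res_diff Q n) (f \o dX n) (projX n.+1).
    by [].
  exists g; split=> //; split=> // x.
  have /res_exactS[y ->] : res_diff Q n (g (dX n.+1 x)) = 0.
    by rewrite hg /= dd linear0.
  by exists y.
by exists phi; split=> //; case: (phiP 0).
Qed.

Lemma res_aug_diff (N : lmodType R) (Q : proj_resolution N) x :
  res_aug Q (res_diff Q 0 x) = 0.
Proof. by apply/res_exact0; exists x. Qed.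

Lemma res_diff_diff (N : lmodType R) (Q : proj_resolution N) n x :
  res_diff Q n (res_diff Q n.+1 x) = 0.
Proof. by apply/res_exactS; exists x. Qed.

Lemma resolution_homotopy (N : lmodType R) (Q : proj_resolution N)
    (phi : forall n, {linear Q n -> Q n}) :
  (forall x, res_aug Q (phi 0%N x) = 0) ->
  (forall n x, res_diff Q n (phi n.+1 x) = phi n (res_diff Q n x)) ->
  exists h : forall n, {linear Q n -> Q n.+1},
    (forall x, phi 0%N x = res_diff Q 0 (h 0%N x)) /\
    forall n x, phi n.+1 x = res_diff Q n.+1 (h n.+1 x) + h n (res_diff Q n x).
Proof.
move=> aug0 phid.
have [||h [hP hQ]] := @dependent_choice_nat (fun n => {linear Q n -> Q n.+1})
  (fun n h => (forall x, res_diff Q n (phi n.+1 x - h (res_diff Q n x)) = 0) /\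
     match n return {linear Q n -> Q n.+1} -> Prop with
     | 0 => fun h => forall x, phi 0%N x = res_diff Q 0 (h x)
     | _ => fun=> True
     end h)
  (fun n h h' => forall x, phi n.+1 x = res_diff Q n.+1 (h' x) + h (res_diff Q n x)).
- have [|h hh] := @projective_lift _ _ _ (res_diff Q 0) (phi 0%N) (@res_projective _ _ Q 0).
    by move=> x; have /res_exact0[y ->] := aug0 x; exists y.
  exists h; split=> // x.
  by rewrite linearB /= phid hh subrr.
- move=> n h [hh _].
  have [|h' hh'] := @projective_lift _ _ _ (res_diff Q n.+1)
      (phi n.+1 \- (h \o res_diff Q n)) (@res_projective _ _ Q n.+1).
    by move=> x; have /res_exactS[y e] := hh x; exists y; rewrite -e.
  exists h'; split; last by move=> x; rewrite hh' /= subrK.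
  by split=> // x; rewrite linearB /= phid hh' /= res_diff_diff linear0 subr0 subrr.
exists h; split; first by case: (hP 0%N).
by [].
Qed.

End Comparison.

(** * Linear forms on M with values in the residue field *)

Section Functional.
Variables (R : comNzRingType) (m : ideal R).
Hypotheses (noeth : noetherian R) (m_local : is_local m).
Variable M : lmodType R.

(** By Zorn's lemma there is a submodule A maximal among those that contain m M and
miss y. Then M = A + R y, and M / A is generated by y and killed by m, so it is a
copy of k. *)
Lemma residue_functional (y : M) : canonical_map m M y != 0 ->
  exists v : {linear M -> residue_field m}, v y != 0.
Proof.
move=> piy.
have hm := maxid_ideal m.
have m1 : 1 \notin m by apply/negP; exact: maxid_proper m_local.
pose N0 : set M := fun u => u \in ideal_mul m M.
have N0y : ~ N0 y.
  move=> h; move/negP: piy; apply; apply/eqP.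
  rewrite -[RHS](linear0 (canonical_map m M)).
  by apply/quotmod_piP; rewrite subr0.
have mN0 a u : a \in m -> N0 (a *: u).
  move=> ma; apply/asboolP; exists 1%N, (fun=> a), (fun=> u).
  by rewrite big_ord1.
pose sub (A : set M) := A 0 /\ forall a u w, A u -> A w -> A (a *: u + w).
have subN0 : sub N0 by case: (submodule_closed (ideal_mul m M)).
pose good (A : set M) := [/\ sub A, (N0 `<=` A)%classic & ~ A y].
have goodN0 : good N0 by split.
(* The empty set is admitted only to have an upper bound for the empty chain. *)
have [|A [[A0|[[A0 AS] NA nAy]] Amax]] := @Zorn_bigcup M (fun A => A = set0 \/ good A).
- move=> F FP Ftot.
  have [[A0 [FA0 gA0]]|nog] := pselect (exists A, F A /\ good A); last first.
    left; rewrite -subset0 => x [A FA Ax].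
    case: (FP A FA) => [e|gA]; first by rewrite e in Ax.
    by apply: nog; exists A.
  right; split.
  - split; first by exists A0 => //; case: gA0 => [[]].
    move=> a u w [B FB Bu] [C FC Cw].
    have up X x : F X -> X x -> good X.
      by move=> FX Xx; case: (FP X FX) => // e; rewrite e in Xx.
    have [[_ BS] _ _] := up B u FB Bu; have [[_ CS] _ _] := up C w FC Cw.
    case: (Ftot B C FB FC) => le.
      by exists C => //; apply: CS => //; apply: le.
    by exists B => //; apply: BS => //; apply: le.
  - by move=> x Nx; exists A0 => //; case: gA0 => _ + _; apply.
  - by move=> [B FB By]; case: (FP B FB) => [e|[_ _]]; [rewrite e in By | apply].
- exfalso; apply: (Amax N0); last by right.
  rewrite A0; split; first by move=> ?.
  by move=> /(_ 0); apply; case: subN0.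
have AZ a u : A u -> A (a *: u) by move=> Au; rewrite -[_ *: _]addr0; apply: AS.
have AD u w : A u -> A w -> A (u + w).
  by move=> Au Aw; rewrite -[u]scale1r; apply: AS.
have cancel u x : u \notin m -> A (u *: x) -> A x.
  move=> /negP nu Aux; have [d du] := unit_notin_maxid noeth m_local nu.
  by rewrite -[x]scale1r -du -scalerA; apply: AZ.
have coord w : exists r : R, A (w - r *: y).
  have [Aw|nAw] := pselect (A w); first by exists 0; rewrite scale0r subr0.
  pose B : set M := fun z => exists c, A (z - c *: w).
  have AB : (A `<` B)%classic.
    split; first by move=> z Az; exists 0; rewrite scale0r subr0.
    by move=> /(_ w) h; apply/nAw/h; exists 1; rewrite scale1r subrr.
  have [c Ac] : B y.
    apply: contrapT => nBy; apply: (Amax B AB); right; split=> //.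
      split; first by exists 0; rewrite scale0r subr0.
      move=> a z z' [c Az] [c' Az']; exists (a * c + c').
      have -> : a *: z + z' - (a * c + c') *: w = a *: (z - c *: w) + (z' - c' *: w).
        by rewrite scalerDl scalerBr scalerA opprD addrACA.
      exact: AS.
    by move=> z /NA Az; exists 0; rewrite scale0r subr0.
  have nc : c \notin m.
    apply/negP => mc; apply: nAy; rewrite -[y](subrK (c *: w)).
    by apply: AD => //; apply/NA/mN0.
  exists ((sval (cid (unit_notin_maxid noeth m_local (elimN idP nc))))).
  case: cid => d /= dc.
  have -> : w - d *: y = (- d) *: (y - c *: w).
    by rewrite scalerBr !scaleNr scalerA dc scale1r opprK addrC.
  exact: AZ.
have [r hr] := choice coord.
have smallm t : A (t *: y) -> t \in m.
  by move=> Aty; apply: contrapT => /negP nt; apply/nAy/(cancel t).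
have AN u : A u -> A (- u) by rewrite -scaleN1r; apply: AZ.
have [|v vE] := @linear_pack R M (residue_field m) (fun w => quotmod_pi m (r w)).
  move=> a w w'; rewrite -[RHS](linearP (quotmod_pi m)).
  apply/quotmod_piP/smallm.
  have -> : (r (a *: w + w') - (a *: (r w : R^o) + r w')) *: y =
     a *: (w - r w *: y) + (w' - r w' *: y) - (a *: w + w' - r (a *: w + w') *: y).
    rewrite scalerBl scalerDl -[a *: (r w : R^o)]/(a * r w) -scalerA scalerBr.
    by rewrite [a *: w - _ + _]addrACA -opprD opprB [RHS]addrC addrA subrK.
  by apply: AD; [apply: AS | apply: AN].
exists v; rewrite vE; apply/eqP => e.
have rm : r y \in m.
  by rewrite -[r y]subr0; apply/quotmod_piP; rewrite e [RHS](linear0 (quotmod_pi m)).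
move/negP: m1; apply; rewrite -[1](subrK (r y)).
apply: (idealD hm) => //; apply: smallm; rewrite scalerBl scale1r; exact: hr.
Qed.

End Functional.

(** * Vanishing *)

Section MinimalAsProjective.
Variables (R : comNzRingType) (m : ideal R).
Variables (r : nat -> nat) (D : forall n, 'M[R]_(ranks r n.+1, ranks r n)).
Hypothesis res : minimal_resolution m D.

Definition row_class (v : 'rV[R]_(ranks r 0)) : residue_field m :=
  quotmod_pi m (v 0 0).

Fact row_class_linear : linear row_class.
Proof.
by move=> a u v; rewrite /row_class !mxE -(linearP (quotmod_pi m)).
Qed.
HB.instance Definition _ :=
  GRing.isLinear.Build R _ _ *:%R row_class row_class_linear.

Lemma row_class_eq0 v : row_class v = 0 <-> entries (fun x => x \in m) v.
Proof.
have zE : 0 = quotmod_pi m 0 by rewrite [RHS](linear0 (quotmod_pi m)).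
rewrite /row_class zE; split=> [/quotmod_piP|vm].
  by rewrite subr0 => h i j; rewrite !ord1.
by apply/quotmod_piP; rewrite subr0; apply: vm.
Qed.

Definition row_diff n : {linear 'rV[R]_(ranks r n.+1) -> 'rV[R]_(ranks r n)} :=
  mulmxr (D n).

(** Transparent, because the modules and differentials must reduce to row spaces
and matrix products. *)
Definition minimal_proj_resolution : proj_resolution (residue_field m).
Proof.
apply: (@ProjResolution R (residue_field m) (fun n => 'rV[R]_(ranks r n))
  row_diff row_class).
- by move=> n; exact: projective_rows.
- move=> y; exists (const_mx (repr y)); rewrite /= /row_class mxE.
  exact: quotmod_reprK.
- move=> x; split=> [/row_class_eq0 /(minres_aug res)[w ->]|[w ->]].
    by exists w.
  by apply/row_class_eq0; apply: (entries_mulmx w (maxid_ideal m) (minres_entries res (n := 0))).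
move=> n x; split=> [/(minres_exact res)[w ->]|[w ->]]; first by exists w.
by rewrite /row_diff /= -mulmxA (minres_comp res) mulmx0.
Defined.

End MinimalAsProjective.

Section Vanishing.
Variables (R : comNzRingType) (m : ideal R).
Hypotheses (noeth : noetherian R) (m_local : is_local m).
Hypothesis singular : ~ regular_local m.
Variables (M : lmodType R).
Hypothesis M_pd : finite_proj_dim M.

(** The chain maps u, lifting f, and w, lifting a linear form v on M with
v (f e) <> 0, compose to a chain map G -> G that vanishes above the length of F. *)
Lemma minimal_cocycle_vanishes (r : nat -> nat)
    (D : forall n, 'M[R]_(ranks r n.+1, ranks r n)) (res : minimal_resolution m D)
    n (f : {linear 'rV[R]_(ranks r n) -> M}) :
  (forall x, f (x *m D n) = 0) -> forall e, canonical_map m M (f e) = 0.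
Proof.
move=> fD e; apply/eqP; apply: contrapT => /negP fe.
have [v vfe] := residue_functional noeth m_local fe.
have [F [l Fl]] := M_pd.
pose G := minimal_proj_resolution res.
have [|||u [u0 ud]] := @comparison R M (fun c => 'rV[R]_(ranks r (c + n)))
  (fun c => row_diff D (c + n)) f F.
- by move=> c; exact: projective_rows.
- by move=> x; exact: fD.
- by move=> c x; exact: (@res_diff_diff R _ G).
have [|||w [w0 wd]] := @comparison R (residue_field m) F (res_diff F)
  (v \o res_aug F) G.
- by move=> c; exact: res_projective.
- by move=> x /=; rewrite res_aug_diff linear0.
- by move=> c x; exact: res_diff_diff.
pose Psi c : 'M[R]_(ranks r (c + n), ranks r c) := lin1_mx (w c \o u c).
have PsiE c x : x *m Psi c = w c (u c x) by rewrite mul_rV_lin1.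
have mPsi : entries (fun x => x \in m) (Psi 0%N).
  apply: (@bounded_chain_map_minimal _ _ _ _ res _ l).
  - by move=> k a; exact: (cocycle_entries noeth m_local res singular).
  - move=> c; apply/row_matrixP => i; rewrite !row_mul !rowE.
    have := wd c (u c.+1 (delta_mx 0 i)).
    by rewrite ud -!PsiE.
  - move=> c lc; apply/row_matrixP => i; rewrite rowE PsiE.
    by rewrite (Fl c lc (u c _)) linear0 row0.
have /(@row_class_eq0 _ _ r) h : entries (fun x => x \in m) (e *m Psi 0%N).
  exact: (entries_mulmx e (maxid_ideal m) mPsi).
move/negP: vfe; apply; apply/eqP; rewrite -(u0 e) -[LHS]/((v \o res_aug F) (u 0%N e)).
by rewrite -w0 -PsiE.
Qed.

End Vanishing.

(** Let alpha : G -> P and beta : P -> G compare the given resolution with the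
minimal one, and let h be a homotopy from alpha beta to the identity of P. A
cocycle z on P differs from z alpha beta by the coboundary of z h, and z alpha has
values in m M. *)
Theorem mainTheorem1 (R : comNzRingType) (m : ideal R)
  (R_noetherian : noetherian R) (R_local : is_local m)
  (R_singular : ~ regular_local m)
  (M : lmodType R) (M_pd : finite_proj_dim M)
  (P : proj_resolution (residue_field m)) (n : int) (x : Ext P M n) :
  Ext_map (canonical_map m M) x = 0.
Proof.
case: n x => [n|//] x; rewrite -[x]quotmod_reprK.
move: (repr x) => z {x}; rewrite [LHS]Ext_map_natE.
have [r [D res]] := minimal_resolution_exists R_noetherian R_local.
pose G := minimal_proj_resolution res.
have /asboolP[zlin zd] := valP z.
have [z' z'E] := linear_pack zlin.
have [|||alpha [alpha0 alphad]] := @comparison R _ G (res_diff G) (res_aug G) P.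
- by move=> c; exact: res_projective.
- exact: res_aug_diff.
- exact: res_diff_diff.
have [|||beta [beta0 betad]] := @comparison R _ P (res_diff P) (res_aug P) G.
- by move=> c; exact: res_projective.
- exact: res_aug_diff.
- exact: res_diff_diff.
have [||h [h0 hS]] := @resolution_homotopy R _ P (fun c => idfun \- (alpha c \o beta c)).
- by move=> y; rewrite /= linearB /= alpha0 beta0 subrr.
- by move=> c y; rewrite /= linearB /= alphad betad.
have vanish y : canonical_map m M (val z (alpha n (beta n y))) = 0.
  rewrite -z'E.
  apply: (minimal_cocycle_vanishes R_noetherian R_local R_singular M_pd res
            (f := z' \o alpha n)) => e /=.
  rewrite z'E -[e *m D n]/(res_diff G n e) -alphad; exact: zd.
rewrite -[RHS](linear0 (quotmod_pi _)); apply/quotmod_piP; rewrite subr0.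
apply/asboolP; case: n z zlin zd z' z'E vanish => [|n] z zlin zd z' z'E vanish.
  move=> y /=; rewrite -[RHS](vanish y); congr (canonical_map m M _).
  apply/eqP; rewrite -!z'E -subr_eq0 -linearB.
  by rewrite -[_ - _]/((idfun \- (alpha 0%N \o beta 0%N)) y) h0 z'E zd.
exists (canonical_map m M \o z' \o h n).
  by move=> a u v; rewrite /= !linearP.
move=> y /=; apply/eqP; rewrite -subr_eq0 -linearB /=.
rewrite -[X in _ == X](vanish y); apply/eqP; congr (canonical_map m M _).
rewrite -!z'E -linearB; apply/eqP; rewrite -subr_eq0 -linearB.
have -> : y - h n (res_diff P n y) - alpha n.+1 (beta n.+1 y) =
    res_diff P n.+1 (h n.+1 y).
  have := hS n y; rewrite /= => e.
  by rewrite addrAC e addrK.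
by rewrite z'E zd.
Qed.
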